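(* Let $Q$ be an ST-compatible ordered quiver. Then: (1) Every ST-tile of $Q$ is a locally transitive tournament. (2) Every ST-tile is colored in such a way that every set of three of its nodes forms either a 3-cycle or a 3-pseudocycle. (3) The equivalent angles belonging to an ST-tile have the same cyclic order for their variables, i.e. the ordered products defining the angles $\Delta_f(k)$, for $(k,f)$ running over the node-sides of the ST-tile, list the nodes of the tile in one and the same cyclic order.
   Context: Quivers. All quivers are finite. A quiver is an oriented graph (multiple arrows allowed) without self-loops and without oriented 2-cycles; $Q_0$ is its set of nodes. A 2-colored quiver is a quiver whose arrows are partitioned into parallel arrows (color $t=0$) and crossing arrows (color $t=1$). Its pruned quiver $Q^{\mathrm{pr}}$ is obtained by removing all pairs formed by a parallel and a crossing arrow between the same two nodes. An ordered quiver is a 2-colored quiver $Q$ together with, at every node $k$, a splitting of the incoming and outgoing arrows of $Q^{\mathrm{pr}}$ at $k$ into ordered tuples $\mathrm{In}_f(k)$, $\mathrm{Out}_f(k)$, $f\in\mathbb{Z}/2\mathbb{Z}$ (possibly empty); $f$ labels the two ''sides'' of the node. An arrow of $Q^{\mathrm{pr}}$ of color $t$ from side $f$ of $i$ to side $g$ of $j$ is written $i\xrightarrow{f\,t\,g}j$. Quiver algebra. $\mathcal{Q}_Q$ is the $\mathbb{Q}$-algebra generated by $X_i^{(f)},Y_i^{(f)}$ ($i\in Q_0$, $f\in\mathbb{Z}/2\mathbb{Z}$) subject to $X_i^{(f)}Y_i^{(f+1)}=Y_i^{(f)}X_i^{(f+1)}$ and $X_i^{(f)}Y_i^{(f+1)}$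 central, localized by the center. It has two commuting involutive anti-automorphisms: $\sigma$ with $X_i^{(f)}\mapsto X_i^{(f+1)}$, $Y_i^{(f)}\mapsto Y_i^{(f+1)}$, and $\tau$ with $X_i^{(f)}\mapsto Y_i^{(f+1)}$, $Y_i^{(f)}\mapsto X_i^{(f+1)}$. Write $X_i:=X_i^{(0)}$; $\sigma\tau$ denotes the composition. Angles. The angle on side $g$ of node $k$ is the ordered product $$\Delta_g(k)=\prod_{i\xrightarrow{f\,t\,g}k\ \in\,\mathrm{In}_g(k)}\sigma^f(\sigma\tau)^{t+1}(X_i)\cdot\sigma^g(X_k)\cdot\prod_{k\xrightarrow{g\,t\,f}j\ \in\,\mathrm{Out}_g(k)}\sigma^f(\sigma\tau)^{t+1}(X_j).$$ The angle relation is $\Delta_g(k)=\sigma(\Delta_g(k))$. Two angle relations are equivalent if imposing one of them in $\mathcal{Q}_Q$ implies the other, and vice versa. $Q$ is ST-compatible (source-target-compatible) if for every arrow $i\xrightarrow{f\,t\,g}j$ of $Q^{\mathrm{pr}}$ the angle relations $\Delta_f(i)=\sigma(\Delta_f(i))$ and $\Delta_g(j)=\sigma(\Delta_g(j))$ are equivalent. ST-tiles. An ST-tile of an ST-compatible $Q$ is a subquiver of $Q^{\mathrm{pr}}$ consisting of all nodes and arrows obtained as follows: start with a node and all arrows of $Q^{\mathrm{pr}}$ lying on one fixed side of it, add the nodes at the other ends of these arrows, then all arrows on the same side of these new nodes as the arrows already included, and repeat until nothing new is added. The pairs $(k,f)$ so encountered are the node-sides of the tile; by ST-compatibility their angle relations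 are all equivalent. A tournament is an orientation of a complete graph; it is transitive if it is totally ordered, and locally transitive if for every node the subquiver on all nodes with an arrow into it, and the subquiver on all nodes receiving an arrow from it, are both transitive. Three nodes form a 3-cycle if the arrows between them form an oriented 3-cycle with an even number of crossing arrows; they form a 3-pseudocycle if the arrows between them form an acyclic triangle with an odd number of crossing arrows. *)

(* Defs.v *)
From HB Require Import structures.
From mathcomp Require Import all_boot all_algebra.
From mathcomp Require Import finmap.
From mathcomp.multinomials Require Import monalg.

Set Implicit Arguments.
Unset Strict Implicit.
Unset Printing Implicit Defensive.

Import GRing.Theory.
Local Open Scope ring_scope.

(* Colors, sides of a node and superscripts (f) are elements of Z/2Z, encoded
   as bool: false is 0, true is 1, and f + 1 is ~~ f. *)

Structure quiver := Quiver {
  node : finType;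
  arrow : finType;
  src : arrow -> node;
  tgt : arrow -> node;
  color : arrow -> bool;    (* false: parallel, true: crossing *)
  no_loop : forall a, src a != tgt a;
  no_2cycle : forall a b, ~~ ((src a == tgt b) && (tgt a == src b))
}.

(* P is the set of arrows that survive the removal of all pairs made of a
   parallel and a crossing arrow between the same two nodes: as many parallel
   as crossing arrows have been removed, and no such pair is left. (Arrows
   between two given nodes all have the same direction.) *)
Definition is_pruning (Q : quiver) (P : {set arrow Q}) : Prop :=
  (forall i j : node Q,
    #|[set a | [&& a \notin P, src a == i, tgt a == j & ~~ color a]]|
    = #|[set a | [&& a \notin P, src a == i, tgt a == j & color a]]|)
  /\ (forall a b, a \in P -> b \in P ->
        src a = src b -> tgt a = tgt b -> color a = color b).

Structure ordered_quiver := OrderedQuiver {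
  quiver_of :> quiver;
  pruned : {set arrow quiver_of};
  prunedP : is_pruning pruned;
  In : node quiver_of -> bool -> seq (arrow quiver_of);
  Out : node quiver_of -> bool -> seq (arrow quiver_of);
  InP : forall k, perm_eq (In k false ++ In k true)
                          (enum [set a in pruned | tgt a == k]);
  OutP : forall k, perm_eq (Out k false ++ Out k true)
                           (enum [set a in pruned | src a == k])
}.

(* A pruned arrow a is an arrow  src a --(sside a, color a, tside a)--> tgt a *)
Definition sside (Q : ordered_quiver) (a : arrow Q) : bool :=
  a \in Out (src a) true.
Definition tside (Q : ordered_quiver) (a : arrow Q) : bool :=
  a \in In (tgt a) true.

Inductive ideal (R : nzRingType) (P : R -> Prop) : R -> Prop :=
| ideal_gen x : P x -> ideal P x
| ideal_zero : ideal P 0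
| ideal_add x y : ideal P x -> ideal P y -> ideal P (x + y)
| ideal_mull a x : ideal P x -> ideal P (a * x)
| ideal_mulr a x : ideal P x -> ideal P (x * a).

Notation free_alg I := {malg rat[{fmonom I}]}.

(* (false, i, f) stands for X_i^(f) and (true, i, f) for Y_i^(f) *)
Notation gen V := (bool * V * bool)%type.
(* inl g is the generator g; inr c is a formal inverse of c if c is to be
   inverted, and is killed otherwise (see loc_rel). *)
Notation loc_gen V := (gen V + free_alg (gen V))%type.

Section QuiverAlgebra.
Variable V : finType.
Local Notation gen := (gen V).
Local Notation loc_gen := (loc_gen V).

Definition X (i : V) (f : bool) : free_alg gen :=
  << fmu ((false, i, f) : gen) >>.
Definition Y (i : V) (f : bool) : free_alg gen :=
  << fmu ((true, i, f) : gen) >>.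

Inductive quiver_rel : free_alg gen -> Prop :=
| rel_XY i f : quiver_rel (X i f * Y i (~~ f) - Y i f * X i (~~ f))
| rel_central i f a :
    quiver_rel (X i f * Y i (~~ f) * a - a * (X i f * Y i (~~ f))).

(* The algebra before localization is free_alg gen modulo ideal quiver_rel;
   the next two predicates speak about the class of c in it. *)
Definition central (c : free_alg gen) : Prop :=
  forall a, ideal quiver_rel (c * a - a * c).
Definition nilpotent (c : free_alg gen) : Prop :=
  exists n, ideal quiver_rel (c ^+ n).

(* The localization by the center inverts every central element that is not
   nilpotent. Nilpotents have to be left out: X_i^(0) Y_i^(1) - X_i^(1) Y_i^(0)
   is central, has square 0 and is nonzero before localization, so inverting it
   would collapse the algebra; it becomes 0 once X_i^(0) Y_i^(1) is inverted. *)
Definition inverted (c : free_alg gen) : Prop := central c /\ ~ nilpotent c.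

Definition to_loc (x : free_alg gen) : free_alg loc_gen :=
  \sum_(m <- msupp x) << x@_m *g FMonom [seq inl g : loc_gen | g <- m : seq gen] >>.

Definition inv_sym (c : free_alg gen) : free_alg loc_gen :=
  << fmu (inr c : loc_gen) >>.

(* The localized quiver algebra is free_alg loc_gen modulo ideal loc_rel. *)
Inductive loc_rel : free_alg loc_gen -> Prop :=
| loc_quiver x : quiver_rel x -> loc_rel (to_loc x)
| loc_invr c : inverted c -> loc_rel (to_loc c * inv_sym c - 1)
| loc_invl c : inverted c -> loc_rel (inv_sym c * to_loc c - 1)
| loc_junk c : ~ inverted c -> loc_rel (inv_sym c).

(* Linear anti-endomorphism given by s on the generators. *)
Definition anti (s : gen -> gen) (x : free_alg gen) : free_alg gen :=
  \sum_(m <- msupp x) << x@_m *g FMonom (rev [seq s g | g <- m : seq gen]) >>.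

Definition sigma : free_alg gen -> free_alg gen :=
  anti (fun g => let: (y, i, f) := g in (y, i, ~~ f)).
Definition tau : free_alg gen -> free_alg gen :=
  anti (fun g => let: (y, i, f) := g in (~~ y, i, ~~ f)).

(* In the localized algebra, imposing x = x' implies y = y'. *)
Definition imposing_implies (x x' y y' : free_alg gen) : Prop :=
  ideal (fun z => loc_rel z \/ z = to_loc x - to_loc x')
        (to_loc y - to_loc y').

End QuiverAlgebra.

Section Angles.
Variable Q : ordered_quiver.
Local Notation V := (node Q).

Definition angle_factor (i : V) (f t : bool) : free_alg (gen V) :=
  iter f (@sigma V) (iter t.+1 (@sigma V \o @tau V) (X i false)).

Definition angle (k : V) (g : bool) : free_alg (gen V) :=
  (\prod_(a <- In k g) angle_factor (src a) (sside a) (color a))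
  * iter g (@sigma V) (X k false)
  * \prod_(a <- Out k g) angle_factor (tgt a) (tside a) (color a).

(* The nodes of the successive factors of angle k g. *)
Definition angle_nodes (k : V) (g : bool) : seq V :=
  [seq src a | a <- In k g] ++ k :: [seq tgt a | a <- Out k g].

Definition angle_rel_implies (k : V) (f : bool) (l : V) (g : bool) : Prop :=
  imposing_implies (angle k f) (sigma (angle k f))
                   (angle l g) (sigma (angle l g)).

Definition angle_rel_equiv (k : V) (f : bool) (l : V) (g : bool) : Prop :=
  angle_rel_implies k f l g /\ angle_rel_implies l g k f.

Definition ST_compatible : Prop :=
  forall a, a \in pruned Q ->
    angle_rel_equiv (src a) (sside a) (tgt a) (tside a).

Definition side_adj (p q : V * bool) : bool :=
  [exists a in pruned Q,
    let s := (src a, sside a) in let t := (tgt a, tside a) in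
    ((p == s) && (q == t)) || ((p == t) && (q == s))].

(* The ST-tile started at side p.2 of the node p.1. *)
Definition tile_sides (p : V * bool) : {set V * bool} :=
  [set q | connect side_adj p q].
Definition tile_nodes (p : V * bool) : {set V} :=
  [set q.1 | q in tile_sides p].
Definition tile_arrows (p : V * bool) : {set arrow Q} :=
  [set a in pruned Q | ((src a, sside a) \in tile_sides p)
                    || ((tgt a, tside a) \in tile_sides p)].

End Angles.

Section Subquivers.
Variable Q : quiver.
Implicit Types (N S : {set node Q}) (A : {set arrow Q}).

(* A subquiver is given by its set N of nodes and its set A of arrows. *)

Definition full_arrows A S : {set arrow Q} :=
  [set a in A | (src a \in S) && (tgt a \in S)].

Definition has_arrow A : rel (node Q) :=
  fun i j => [exists a in A, (src a == i) && (tgt a == j)].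

Definition tournament N A : Prop :=
  (forall a, a \in A -> src a \in N /\ tgt a \in N)
  /\ (forall i j, i \in N -> j \in N -> i != j ->
        #|full_arrows A [set i; j]| = 1%N).

Definition transitive_tournament N A : Prop :=
  tournament N A /\ {in N & &, transitive (has_arrow A)}.

Definition locally_transitive_tournament N A : Prop :=
  tournament N A
  /\ forall k, k \in N ->
       let I := [set i in N | has_arrow A i k] in
       let J := [set j in N | has_arrow A k j] in
       transitive_tournament I (full_arrows A I)
       /\ transitive_tournament J (full_arrows A J).

Definition oriented_triangle A S : Prop :=
  exists a b c, [/\ full_arrows A S = [set a; b; c],
    S = [set src a; src b; src c],
    tgt a = src b, tgt b = src c & tgt c = src a].

Definition acyclic_triangle A S : Prop :=
  exists a b c, [/\ full_arrows A S = [set a; b; c],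
    S = [set src a; src b; tgt b],
    tgt a = src b, src c = src a & tgt c = tgt b].

Definition num_crossing A S : nat := #|[set a in full_arrows A S | color a]|.

Definition three_cycle A S : Prop :=
  oriented_triangle A S /\ ~~ odd (num_crossing A S).
Definition three_pseudocycle A S : Prop :=
  acyclic_triangle A S /\ odd (num_crossing A S).

End Subquivers.

(* Main.v *)
(* In the localized algebra Y_i^(f) is N_i times the inverse of X_i^(f+1), where
   N_i is central, so an angle relation becomes a relation w = mirror w between
   words in a free group. To compare two such relations one needs many models of
   the localized algebra. Let X_i^(f) act by arbitrary elements of a finite group
   and let the N_i be algebraically independent: a central element that is not
   nilpotent then acts by a nonzero scalar, because the group ring of a free group
   has only scalars in its center and the map to this group ring has a nil kernel.
   Hence equivalent angle relations hold for the same assignments of elements of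
   finite groups to the X_i^(f).
   The relation of (k, f) can be solved for X_k^(f), and assignments in finite
   groups show, first, that no node occurs twice in an angle and, second, that
   angles of adjacent node-sides are rotations of each other, a letter that moves
   across the end of the word being exchanged (X with Y). All angles of a tile
   thus list its nodes in one cyclic order. In this order the targets of the arrows
   leaving a node come right after it and the sources of the entering ones right
   before it, which gives local transitivity; the exchanges of X and Y give the
   parity of the crossings in a triangle. *)

From HB Require Import structures.
From Stdlib Require Import ClassicalEpsilon.
Set Warnings "-notation-overridden,-notation-incompatible-prefix,-ambiguous-paths".
From mathcomp Require Import all_boot all_algebra all_fingroup.
(* The notations of mpoly clash with those of monalg. *)
From mathcomp.multinomials Require Import -(notations) mpoly.
From mathcomp Require Import finmap.
From mathcomp.multinomials Require Import monalg.
From mathcomp Require Import zify.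
Require Import Defs.

Set Implicit Arguments.
Unset Strict Implicit.
Unset Printing Implicit Defensive.

Import GRing.Theory.
Local Open Scope ring_scope.

(* Failed conversions between products of the free algebra diverge otherwise; for
   the same reason [mon] is locked and identities between products are proved in an
   arbitrary ring. *)
Local Opaque fgmul fgadd fgopp fgzero fgone fgscale mkmalgU mmap X Y.

(** * Ideals and evaluation of the free algebra *)

Section Ideals.
Variables (R : nzRingType) (P : R -> Prop).

Lemma ideal_opp x : ideal P x -> ideal P (- x).
Proof. by rewrite -mulN1r; apply: ideal_mull. Qed.

Lemma ideal_sub x y : ideal P x -> ideal P y -> ideal P (x - y).
Proof. by move=> Px Py; apply: ideal_add => //; apply: ideal_opp. Qed.

Lemma ideal_min (J : R -> Prop) : ideal J 0 ->
  (forall x, P x -> ideal J x) -> forall x, ideal P x -> ideal J x.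
Proof.
move=> J0 PJ x; elim=> {x}; [exact: PJ | by [] | | |] => *.
- exact: ideal_add.
- exact: ideal_mull.
- exact: ideal_mulr.
Qed.

End Ideals.

Section MonoidAlgebras.
Variable M : monomType.

Lemma malg_ind (P : {malg rat[M]} -> Prop) : P 0 ->
  (forall c m x, P x -> P (<< c *g m >> + x)) -> forall x, P x.
Proof.
by move=> P0 PD x; rewrite [x]monalgE; elim/big_rec: _ => // m y _; apply: PD.
Qed.

Lemma malgUM (c d : rat) (m n : M) :
  << c *g m >> * << d *g n >> = << c * d *g mmul m n >> :> {malg rat[M]}.
Proof. by rewrite malgM_def fgmulUU. Qed.

Lemma malgUZ (c : rat) (m : M) : << c *g m >> = c *: << m >> :> {malg rat[M]}.
Proof. by rewrite -mul_malgC malgUM mulr1 mul1m. Qed.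

End MonoidAlgebras.

HB.lock Definition mon (I : choiceType) (w : seq I) : {malg rat[{fmonom I}]} :=
  << FMonom w >>.
Arguments mon {I} w.

Section FreeAlgebras.
Variable I : choiceType.
Implicit Types (g : I) (u v w : seq I) (m : {fmonom I}).

Lemma fmonomM (u v : seq I) : mmul (FMonom u) (FMonom v) = FMonom (u ++ v).
Proof. by apply/val_inj; rewrite /= fmM. Qed.

Lemma fmonom_nil : FMonom [::] = mone :> {fmonom I}.
Proof. by apply/val_inj; rewrite /= fm1. Qed.

Lemma mon_nil : @mon I [::] = 1.
Proof. by rewrite mon.unlock fmonom_nil. Qed.

Lemma mon_cat u v : mon (u ++ v) = mon u * mon v.
Proof. by rewrite mon.unlock malgUM fmonomM mulr1. Qed.

Lemma mon_cons g v : mon (g :: v) = mon [:: g] * mon v.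
Proof. exact: (mon_cat [:: g]). Qed.

Lemma mon_fmu g : << fmu g >> = mon [:: g].
Proof. by rewrite mon.unlock fmuE. Qed.

Lemma mon_fmonom (m : {fmonom I}) : << m >> = mon m.
Proof. by rewrite mon.unlock fmK. Qed.

End FreeAlgebras.

Section Evaluation.
Variables (I : choiceType) (K : comNzRingType) (R : algType K).
Variables (iota : {rmorphism rat -> K}) (rho : I -> R).

Definition monom_val (m : {fmonom I}) : R := \prod_(g <- (m : seq I)) rho g.

Lemma monom_val_mmorphism : mmorphism monom_val.
Proof.
by split=> [u v|]; rewrite /monom_val ?fmM ?big_cat // fm1 big_nil.
Qed.

HB.instance Definition _ :=
  monalg.isMultiplicative.Build _ _ monom_val monom_val_mmorphism.

Definition eval : {malg rat[{fmonom I}]} -> R :=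
  mmap (in_alg R \o iota) monom_val.

Lemma eval_is_zmod_morphism : zmod_morphism eval.
Proof. exact: mmap_is_additive. Qed.

HB.instance Definition _ :=
  GRing.isZmodMorphism.Build _ _ eval eval_is_zmod_morphism.

Lemma eval_is_monoid_morphism : monoid_morphism eval.
Proof.
suff [evM ev1]: {morph eval : x y / x * y} * (eval 1 = 1) by [].
apply: commr_mmap_is_multiplicative => g m m'.
by rewrite /GRing.comm /= -scalerAl -scalerAr mulr1 mul1r.
Qed.

HB.instance Definition _ :=
  GRing.isMonoidMorphism.Build _ _ eval eval_is_monoid_morphism.

Lemma evalE x :
  eval x = \sum_(m <- msupp x) iota x@_m *: \prod_(g <- (m : seq I)) rho g.
Proof.
by rewrite /eval mmapE; apply: eq_bigr => m _; rewrite /= -scalerAl mul1r.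
Qed.

Lemma eval_monomZ c w : eval << c *g FMonom w >> = iota c *: \prod_(g <- w) rho g.
Proof. by rewrite /eval mmapU /= -scalerAl mul1r. Qed.

Lemma eval_mon w : eval (mon w) = \prod_(g <- w) rho g.
Proof. by rewrite mon.unlock eval_monomZ rmorph1 scale1r. Qed.

Lemma eval_ideal (P : {malg rat[{fmonom I}]} -> Prop) x :
  (forall x, P x -> eval x = 0) -> ideal P x -> eval x = 0.
Proof.
move=> evP; elim=> {x} [x /evP //||x y _ ex _ ey|a x _ ex|a x _ ex].
- exact: rmorph0.
- by rewrite rmorphD /= ex ey addr0.
- by rewrite rmorphM /= ex mulr0.
- by rewrite rmorphM /= ex mul0r.
Qed.

End Evaluation.

(** * Reduced words and central elements *)

Lemma sum_by_class (T : eqType) (C : eqType) (A : zmodType) (r : seq T)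
    (f : T -> C) (F : T -> A) :
  \sum_(x <- r) F x
    = \sum_(c <- undup (map f r)) \sum_(x <- r | f x == c) F x.
Proof.
elim: r => [|x r IHr]; first by rewrite !big_nil.
rewrite big_cons IHr /=.
have shift c : \sum_(y <- x :: r | f y == c) F y
    = (if f x == c then F x else 0) + \sum_(y <- r | f y == c) F y.
  by rewrite big_cons; case: ifP => // _; rewrite add0r.
under [RHS]eq_bigr do rewrite shift.
rewrite big_split /=; case: ifP => [fx_r | /negbT fx_nr].
  congr (_ + _).
  rewrite (bigD1_seq (f x)) ?undup_uniq ?mem_undup //= eqxx big1 ?addr0 // => c.
  by rewrite eq_sym => /negPf->.
have -> : \sum_(c <- f x :: undup (map f r)) (if f x == c then F x else 0) = F x.
  rewrite big_cons eqxx big1_seq ?addr0 // => c; rewrite mem_undup => /andP[_ c_r].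
  by case: eqP => // fx_c; rewrite fx_c c_r in fx_nr.
have fx0 : \sum_(y <- r | f y == f x) F y = 0.
  by apply: big1_seq => y /andP[/eqP fy yr]; rewrite -fy map_f in fx_nr.
by rewrite big_cons fx0 add0r.
Qed.

Section ReducedWords.
Variable V : finType.
Local Notation gen := (gen V).
Implicit Types (g h : gen) (u v w : seq gen).

(* The letters X_i^(f) and Y_i^(f+1), whose product is central. *)
Definition inv_gen g : gen := (~~ g.1.1, g.1.2, ~~ g.2).

Lemma inv_genK : involutive inv_gen.
Proof. by case=> [[y i] f]; rewrite /inv_gen /= !negbK. Qed.

Lemma inv_gen_neq g : (inv_gen g == g) = false.
Proof. by case: g => [[[] i] f]; apply/eqP. Qed.

Definition reduced : pred (seq gen) := sorted (fun g h => h != inv_gen g).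

(** On reduced words this is left multiplication by [g] in the free group where [inv_gen g] is
    inverse to [g]. Words act on reduced words through [push], as in van der Waerden's proof of the
    normal form theorem. *)
Definition push g w : seq gen :=
  if w is h :: w' then if h == inv_gen g then w' else g :: w else [:: g].

Definition reduce_onto v u : seq gen := foldr push v u.

Definition reduce u : seq gen := reduce_onto [::] u.

Lemma reduced_push g w : reduced w -> reduced (push g w).
Proof.
case: w => //= h w rw; case: ifP => [_ | /negbT gh] /=.
  exact: path_sorted rw.
by rewrite gh.
Qed.

Lemma reduced_reduce_onto v u : reduced v -> reduced (reduce_onto v u).
Proof. by move=> rv; elim: u => //= g u; apply: reduced_push. Qed.

Lemma reduced_reduce u : reduced (reduce u).
Proof. exact: reduced_reduce_onto. Qed.

Lemma reduce_id w : reduced w -> reduce w = w.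
Proof.
elim: w => //= g w IHw rw; rewrite /reduce /= -/(reduce w) (IHw (path_sorted rw)).
by case: w rw {IHw} => //= h w /andP[/negPf->].
Qed.

Lemma pushK g w : reduced w -> push g (push (inv_gen g) w) = w.
Proof.
case: w => [|h w] /=; first by rewrite eqxx.
rewrite inv_genK; case: eqP => [-> | _] /=; last by rewrite eqxx.
by case: w => //= k w /andP[/negPf->].
Qed.

Lemma push_inj g : {in [pred w | reduced w] &, injective (push g)}.
Proof.
have K w : reduced w -> push (inv_gen g) (push g w) = w.
  by move=> rw; rewrite -{2}[g]inv_genK pushK.
by move=> u v ru rv /(congr1 (push (inv_gen g))); rewrite !K.
Qed.

(** Cancelling a pair before acting changes nothing, because its two letters act on reduced words as
    mutually inverse maps ([pushK]). *)
Lemma reduce_onto_reduce v u : reduced v -> reduce_onto v (reduce u) = reduce_onto v u.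
Proof.
move=> rv; elim: u => //= g u IHu; rewrite -IHu -/(reduce u).
have: reduced (reduce u) by apply: reduced_reduce.
case: (reduce u) => //= h w rw; case: ifP => // /eqP ->.
by rewrite pushK //; apply: reduced_reduce_onto.
Qed.

Lemma reduce_cat u v : reduce (u ++ v) = reduce_onto (reduce v) (reduce u).
Proof.
by rewrite reduce_onto_reduce ?reduced_reduce // /reduce /reduce_onto foldr_cat.
Qed.

Lemma reduce_catr u v w : reduce u = reduce v -> reduce (u ++ w) = reduce (v ++ w).
Proof. by rewrite !reduce_cat => ->. Qed.

Lemma reduce_pair g u : reduce [:: g, inv_gen g & u] = reduce u.
Proof. exact/pushK/reduced_reduce. Qed.

Lemma reduce_catV u g : reduce (u ++ [:: g; inv_gen g]) = reduce u.
Proof. by rewrite reduce_cat (reduce_pair g [::]) reduce_onto_reduce. Qed.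

End ReducedWords.

Section Commutators.
Variable R : nzRingType.
Implicit Types x y a b d p q : R.

Lemma commutatorB x y a :
  (x - y) * a - a * (x - y) = (x * a - a * x) - (y * a - a * y).
Proof.
rewrite mulrBl mulrBr !opprB [LHS]addrACA [RHS]addrACA; congr (_ + _).
by rewrite addrC.
Qed.

Lemma commutatorM x y a :
  x * y * a - a * (x * y) = x * (y * a - a * y) + (x * a - a * x) * y.
Proof. by rewrite mulrBl mulrBr !mulrA addrA subrK. Qed.

Lemma subr_addM x y a b d : x + y - (a + b) * d = (x - a * d) + (y - b * d).
Proof. by rewrite mulrDl opprD addrACA. Qed.

Lemma subr_mulM x a b d : b * x - b * a * d = b * (x - a * d).
Proof. by rewrite mulrBr mulrA. Qed.

Lemma mulr_commutator x a b d :
  x * b - a * b * d = (x - a * d) * b + a * (d * b - b * d).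
Proof. by rewrite mulrBl mulrBr !mulrA addrA subrK. Qed.

Lemma pair_commutator x y p q :
  (x * y - p * q) * x = x * (y * x - p * q) - (p * q * x - x * (p * q)).
Proof. by rewrite mulrBl mulrBr !mulrA opprB addrA subrK. Qed.

Lemma sqr_commutator x a d :
  x * x = (x - a * d) * x + a * (d * x - x * d) + a * ((x - a * d) * d)
          + a * a * (d * d).
Proof. by rewrite !mulrBl !mulrBr !mulrA !addrA !subrK. Qed.

Lemma mulr_subM x y p q :
  x * y - p * (x * q) = x * (y - p * q) + (x * p - p * x) * q.
Proof. by rewrite mulrBl mulrBr !mulrA addrA subrK. Qed.

End Commutators.

Section CentralSquareZero.
Variables (R : nzRingType) (P : R -> Prop) (V : eqType) (d : V -> R).
Hypothesis d_central : forall i a, ideal P (d i * a - a * d i).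
Hypothesis d_sqr : forall i, ideal P (d i * d i).
Implicit Types (i : V) (s : seq V) (a x y : R).

Definition enlarged s : R -> Prop :=
  ideal (fun x => P x \/ exists2 i, i \in s & x = d i).

Lemma ideal_enlarged s x : ideal P x -> enlarged s x.
Proof.
by apply: ideal_min => [|y py]; [apply: ideal_zero | apply: ideal_gen; left].
Qed.

(** Since [d i] is central modulo [P], its occurrences in an element of the ideal can be collected
    into a single left multiple [a * d i]. *)
Lemma enlarged_cons i s x :
  enlarged (i :: s) x -> exists a, enlarged s (x - a * d i).
Proof.
elim=> {x} [x [px | [j jis ->]] | | x y _ [a Ja] _ [b Jb] | b x _ [a Ja]
           | b x _ [a Ja]].
- by exists 0; rewrite mul0r subr0; apply: ideal_gen; left.
- have [->|ji] := eqVneq j i.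
    by exists 1; rewrite mul1r subrr; apply: ideal_zero.
  exists 0; rewrite mul0r subr0; apply: ideal_gen; right; exists j => //.
  by move: jis; rewrite inE (negPf ji).
- by exists 0; rewrite mul0r subr0; apply: ideal_zero.
- by exists (a + b); rewrite subr_addM; apply: ideal_add.
- by exists (b * a); rewrite subr_mulM; apply: ideal_mull.
- exists (a * b).
  have -> : x * b - a * b * d i
      = (x - a * d i) * b + a * (d i * b - b * d i).
    exact: mulr_commutator.
  apply: ideal_add; first exact: ideal_mulr.
  exact/ideal_mull/ideal_enlarged/d_central.
Qed.

(** The [d i] are removed one at a time: if [x] is [a * d i] modulo the smaller ideal, then [x * x]
    lies in that ideal, because [d i] is central of square zero. Each removal doubles the
    exponent. *)
Lemma enlarged_nilpotent s x : enlarged s x -> exists n, ideal P (x ^+ n).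
Proof.
elim: s x => [|i s IHs] x.
  move=> Jx; exists 1; rewrite expr1; move: Jx; apply: ideal_min.
    exact: ideal_zero.
  by move=> y [py | [j]]; [apply: ideal_gen | rewrite in_nil].
move=> /enlarged_cons[a Ja].
suff /IHs[n xn] : enlarged s (x * x).
  by exists (2 * n)%N; rewrite exprM expr2.
have -> : x * x = (x - a * d i) * x + a * (d i * x - x * d i)
    + a * ((x - a * d i) * d i) + a * a * (d i * d i).
  exact: sqr_commutator.
do !apply: ideal_add.
- exact: ideal_mulr.
- exact/ideal_mull/ideal_enlarged/d_central.
- exact/ideal_mull/ideal_mulr.
- exact/ideal_mull/ideal_enlarged/d_sqr.
Qed.

End CentralSquareZero.

Section CentralProducts.
Variables (R : nzRingType) (P : R -> Prop) (V : eqType) (z : V -> R).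
Hypothesis z_central : forall i a, ideal P (z i * a - a * z i).
Implicit Types (i : V) (s t : seq V) (a : R).

Definition central_prod s : R := \prod_(i <- s) z i.

Lemma central_prod_central s a :
  ideal P (central_prod s * a - a * central_prod s).
Proof.
rewrite /central_prod; elim: s a => [|i s IHs] a.
  by rewrite !big_nil mulr1 mul1r subrr; apply: ideal_zero.
rewrite big_cons; set p := \prod_(i <- s) _.
have -> : z i * p * a - a * (z i * p)
    = z i * (p * a - a * p)
      + (z i * a - a * z i) * p.
  exact: commutatorM.
by apply: ideal_add; [apply: ideal_mull | apply/ideal_mulr/z_central].
Qed.

Lemma central_prod_perm s t : perm_eq s t ->
  ideal P (central_prod s - central_prod t).
Proof.
elim: s t => [|i s IHs] t st.
  have /perm_nilP -> : perm_eq t [::] by rewrite perm_sym.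
  by rewrite subrr; apply: ideal_zero.
have it : i \in t by rewrite -(perm_mem st) mem_head.
case/splitPr: it st => t1 t2 st; have {st}/IHs: perm_eq s (t1 ++ t2).
  by rewrite -(perm_cons i) (perm_trans st) // perm_catC /= perm_cons perm_catC.
rewrite /central_prod !big_cat !big_cons /=.
set p := \prod_(j <- s) _; set p1 := \prod_(j <- t1) _; set p2 := \prod_(j <- t2) _.
move=> sp; have -> : z i * p - p1 * (z i * p2)
    = z i * (p - p1 * p2)
      + (z i * p1 - p1 * z i) * p2.
  exact: mulr_subM.
by apply: ideal_add; [apply: ideal_mull | apply/ideal_mulr/z_central].
Qed.

End CentralProducts.

Section QuiverIdeal.
Variable V : finType.
Local Notation gen := (gen V).
Local Notation FA := (free_alg gen).
Implicit Types (g h : gen) (u v w : seq gen) (i : V) (s : seq V) (a x y : FA).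

Lemma X_mon i f : X i f = mon [:: (false, i, f)].
Proof. exact: mon_fmu. Qed.

Lemma Y_mon i f : Y i f = mon [:: (true, i, f)].
Proof. exact: mon_fmu. Qed.

Lemma XY_mon i f e : X i f * Y i e = mon [:: (false, i, f); (true, i, e)].
Proof. by rewrite X_mon Y_mon -mon_cat. Qed.

Lemma YX_mon i f e : Y i f * X i e = mon [:: (true, i, f); (false, i, e)].
Proof. by rewrite X_mon Y_mon -mon_cat. Qed.

Definition norm_gen i f : FA := X i f * Y i (~~ f).

Definition defect i : FA := norm_gen i false - norm_gen i true.

Lemma norm_gen_central i f a :
  ideal (@quiver_rel V) (norm_gen i f * a - a * norm_gen i f).
Proof. exact/ideal_gen/rel_central. Qed.

(** Write X, Y for the letters of superscript f and X', Y' for those of f + 1. Then (X Y') X = X (Y'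
    X) = X (X' Y), which is (X' Y) X because X' Y is central. *)
Lemma norm_gen_X i f :
  ideal (@quiver_rel V) ((norm_gen i f - norm_gen i (~~ f)) * X i f).
Proof.
have -> : (norm_gen i f - norm_gen i (~~ f)) * X i f
    = X i f * (Y i (~~ f) * X i f - X i (~~ f) * Y i f)
      - (norm_gen i (~~ f) * X i f - X i f * norm_gen i (~~ f)).
  by rewrite /norm_gen negbK; apply: pair_commutator.
apply: ideal_sub; last exact: norm_gen_central.
apply: ideal_mull; rewrite -opprB; apply: ideal_opp; apply: ideal_gen.
by have := rel_XY i (~~ f); rewrite negbK.
Qed.

(** Both terms of the second factor start with a letter X_i^(f), and the defect times such a letter
    vanishes by [norm_gen_X]. *)
Lemma defect_sqr i : ideal (@quiver_rel V) (defect i * defect i).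
Proof.
rewrite {2}/defect mulrBr; apply: ideal_sub.
  by rewrite /norm_gen mulrA; apply/ideal_mulr/(norm_gen_X i false).
rewrite /norm_gen mulrA; apply: ideal_mulr; rewrite /defect -opprB mulNr.
exact/ideal_opp/(norm_gen_X i true).
Qed.

Lemma defect_central i a : ideal (@quiver_rel V) (defect i * a - a * defect i).
Proof.
have -> : defect i * a - a * defect i
    = (norm_gen i false * a - a * norm_gen i false)
      - (norm_gen i true * a - a * norm_gen i true).
  exact: commutatorB.
by apply: ideal_sub; apply: norm_gen_central.
Qed.

End QuiverIdeal.

Section Congruences.
Variables (R : nzRingType) (P : R -> Prop).
Implicit Types x y z : R.

Definition eqmod x y := ideal P (x - y).

Lemma eqmod_refl x : eqmod x x.
Proof. by rewrite /eqmod subrr; apply: ideal_zero. Qed.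

Lemma eqmod_sym x y : eqmod x y -> eqmod y x.
Proof. by move=> xy; rewrite /eqmod -opprB; apply: ideal_opp. Qed.

Lemma eqmod_trans y x z : eqmod x y -> eqmod y z -> eqmod x z.
Proof. by move=> xy /(ideal_add xy); rewrite addrA subrK. Qed.

Lemma eqmodM x x' y y' : eqmod x x' -> eqmod y y' -> eqmod (x * y) (x' * y').
Proof.
move=> xx' yy'; rewrite /eqmod.
have -> : x * y - x' * y' = (x - x') * y + x' * (y - y').
  by rewrite mulrBl mulrBr addrA subrK.
by apply: ideal_add; [apply: ideal_mulr | apply: ideal_mull].
Qed.

Lemma eqmod_ideal x y : eqmod x y -> ideal P y -> ideal P x.
Proof. by move=> xy /(ideal_add xy); rewrite subrK. Qed.

Lemma eqmod_sum (T : eqType) (r : seq T) (F G : T -> R) :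
  {in r, forall i, eqmod (F i) (G i)} ->
  eqmod (\sum_(i <- r) F i) (\sum_(i <- r) G i).
Proof.
move=> FG; rewrite /eqmod -sumrB big_seq.
by elim/big_rec: _ => [|i x /FG ? ?]; [apply: ideal_zero | apply: ideal_add].
Qed.

End Congruences.

Section WordsModDefects.
Variable V : finType.
Local Notation gen := (gen V).
Local Notation FA := (free_alg gen).
Implicit Types (g h : gen) (u v w : seq gen) (i : V) (s : seq V).

Definition defect_rel : FA -> Prop :=
  fun x => quiver_rel x \/ exists2 i, i \in enum V & x = defect i.

Local Notation "x =~ y" := (eqmod defect_rel x y) (at level 70) : ring_scope.
Local Notation N i := (norm_gen i false).
Local Notation Ns s := (central_prod (fun i => N i) s).

(** Computing modulo the defects loses only nilpotent elements, and these are excluded by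
    [inverted]. *)
Lemma defect_rel_nilpotent x : ideal defect_rel x -> nilpotent x.
Proof. exact: (enlarged_nilpotent (@defect_central V) (@defect_sqr V)). Qed.

Lemma quiver_eqmod x y : ideal (@quiver_rel V) (x - y) -> x =~ y.
Proof. exact: (@ideal_enlarged _ (@quiver_rel V) _ (@defect V)). Qed.

Lemma norm_gen_eqmod i f : norm_gen i f =~ N i.
Proof.
case: f; last exact: eqmod_refl.
apply: eqmod_sym; apply: ideal_gen; right; exists i => //.
by rewrite mem_enum.
Qed.

Lemma mon_pair g : mon [:: g; inv_gen g] =~ N g.1.2.
Proof.
case: g => [[[] i] f]; rewrite /inv_gen /=.
  apply: eqmod_trans (norm_gen_eqmod i f); apply: eqmod_sym; apply: quiver_eqmod.
  rewrite -YX_mon.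
  exact/ideal_gen/rel_XY.
by rewrite -XY_mon; apply: norm_gen_eqmod.
Qed.

Lemma Ns_central s x : Ns s * x =~ x * Ns s.
Proof.
apply: quiver_eqmod; apply: central_prod_central => i a.
exact: norm_gen_central.
Qed.

Definition ydeg u : {ffun V -> nat} :=
  [ffun i => count (fun g => g.1.1 && (g.1.2 == i)) u].

Lemma ydeg_cat u v : ydeg (u ++ v) = ydeg u + ydeg v.
Proof. by apply/ffunP => i; rewrite !ffunE count_cat. Qed.

Lemma mon_reduce u : exists s,
  (forall i, ydeg u i = ydeg (reduce u) i + count_mem i s)%N
  /\ mon u =~ Ns s * mon (reduce u).
Proof.
elim: u => [|g u [s [degs us]]].
  exists [::]; split=> [i|]; first by rewrite ffunE.
  by rewrite /central_prod big_nil mul1r; apply: eqmod_refl.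
have gu : mon (g :: u) =~ Ns s * (mon [:: g] * mon (reduce u)).
  rewrite mon_cons; apply: (eqmod_trans (eqmodM (eqmod_refl _ _) us)).
  rewrite !mulrA; apply: eqmodM (eqmod_refl _ _).
  exact/eqmod_sym/Ns_central.
rewrite /reduce /= -/(reduce u).
case: (reduce u) degs gu => [|h w] degs gu /=.
  exists s; split=> [i|]; last by move: gu; rewrite mon_nil mulr1.
  by move: (degs i); rewrite !ffunE /= => ->; lia.
case: eqP => [hg | _]; last first.
  exists s; split=> [i|]; last by move: gu; rewrite -mon_cat.
  by move: (degs i); rewrite !ffunE /= => ->; lia.
exists (rcons s g.1.2); split=> [i|].
  move: (degs i); rewrite !ffunE /= hg -cats1 count_cat => -> /=.
  case: (g) => [[y j] f] /=; rewrite addn0.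
  by case: y => /=; case: (j == i); lia.
apply: (eqmod_trans gu); rewrite hg.
have -> : mon [:: g] * mon (inv_gen g :: w) = mon [:: g; inv_gen g] * mon w.
  by rewrite -[LHS]mon_cat -[RHS]mon_cat.
rewrite /central_prod -cats1 big_cat big_seq1 /= -mulrA.
apply: eqmodM (eqmod_refl _ _) _.
by apply: eqmodM (mon_pair g) (eqmod_refl _ _).
Qed.

Lemma mon_eqmod u v :
  ydeg u = ydeg v -> reduce u = reduce v -> mon u =~ mon v.
Proof.
have [s [degs us]] := mon_reduce u; have [t [degt vt]] := mon_reduce v.
move=> deguv red; apply: (eqmod_trans us); apply: eqmod_sym.
apply: (eqmod_trans vt); rewrite red; apply: eqmodM (eqmod_refl _ _).
apply: quiver_eqmod; apply: central_prod_perm => [i a|].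
  exact: norm_gen_central.
apply/allP => i _ /=; apply/eqP/(@addnI (ydeg (reduce v) i)).
by rewrite -degt -red -degs deguv.
Qed.

End WordsModDefects.

Section CentralElements.
Variable V : finType.
Local Notation gen := (gen V).
Local Notation FA := (free_alg gen).
Local Notation cls := ({ffun V -> nat} * seq gen)%type.
Implicit Types (g h : gen) (u v w : seq gen) (d : {ffun V -> nat}) (c x : FA).

(* Up to defects, which are central of square zero, a word is determined by its
   reduced word and by its number of letters Y_i for every i. *)
Definition nf u : cls := (ydeg u, reduce u).

Lemma nf_XY i f : nf [:: (false, i, f); (true, i, ~~ f)]
                   = nf [:: (true, i, f); (false, i, ~~ f)].
Proof.
by rewrite /nf !(reduce_pair _ [::]); congr (_, _).
Qed.

(** Functionals that see only normal forms replace the group ring of the free group over the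
    polynomials in the N_i. The coefficient at one normal form is [coef] below. *)
Definition weight (F : cls -> rat) : FA -> rat :=
  mmap idfun (fun m : {fmonom gen} => F (nf m)).

Lemma weight0 F : weight F 0 = 0.
Proof. exact: mmap0. Qed.

Lemma weightD F x y : weight F (x + y) = weight F x + weight F y.
Proof. exact: mmapD. Qed.

Lemma weightB F x y : weight F (x - y) = weight F x - weight F y.
Proof. exact: mmapB. Qed.

Lemma weight_monom F (a : rat) (m : {fmonom gen}) :
  weight F << a *g m >> = a * F (nf m).
Proof. exact: mmapU. Qed.

Lemma weight_mon F u : weight F (mon u) = F (nf u).
Proof. by rewrite mon.unlock weight_monom mul1r. Qed.

Lemma eq_weight F G x : (forall u, F (nf u) = G (nf u)) -> weight F x = weight G x.
Proof. by move=> FG; rewrite /weight !mmapE; apply: eq_bigr => m _; rewrite FG. Qed.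

Lemma weight_cst0 F x : (forall u, F (nf u) = 0) -> weight F x = 0.
Proof.
by move=> F0; rewrite /weight mmapE big1 // => m _; rewrite F0 mulr0.
Qed.

Lemma weight_mull F (m : {fmonom gen}) (a : rat) x :
  weight F (<< a *g m >> * x)
    = a * weight (fun C => F (ydeg m + C.1, reduce_onto C.2 m)) x.
Proof.
elim/malg_ind: x => [|b m' x IHx]; first by rewrite mulr0 !weight0 mulr0.
rewrite mulrDr !weightD malgUM IHx !weight_monom mulrDr mulrA.
by congr (_ * F _ + _);
   rewrite /nf fmM ydeg_cat /= reduce_cat reduce_onto_reduce ?reduced_reduce.
Qed.

Lemma weight_mulr F (m : {fmonom gen}) (a : rat) x :
  weight F (x * << a *g m >>)
    = a * weight (fun C => F (C.1 + ydeg m, reduce_onto (reduce m) C.2)) x.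
Proof.
elim/malg_ind: x => [|b m' x IHx]; first by rewrite mul0r !weight0 mulr0.
rewrite mulrDl !weightD malgUM IHx !weight_monom mulrDr mulrA [b * a]mulrC.
by congr (_ * F _ + _); rewrite /nf fmM ydeg_cat /= reduce_cat.
Qed.

Lemma weight_mul_mon F u x :
  weight F (mon u * x) = weight (fun C => F (ydeg u + C.1, reduce_onto C.2 u)) x.
Proof. by rewrite mon.unlock weight_mull mul1r. Qed.

Lemma weight_mon_mul F u x :
  weight F (x * mon u)
    = weight (fun C => F (C.1 + ydeg u, reduce_onto (reduce u) C.2)) x.
Proof. by rewrite mon.unlock weight_mulr mul1r. Qed.

(** The induction is uniform in [F], since multiplication by a monomial on either side only replaces
    [F] by a translate ([weight_mull], [weight_mulr]). *)
Lemma weight_ideal F x : ideal (@quiver_rel V) x -> weight F x = 0.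
Proof.
move=> qx; elim: qx F => {x} [x [i f | i f a] F | F | x y _ IHx _ IHy F
  | a x _ IHx F | a x _ IHx F].
- rewrite weightB XY_mon YX_mon !weight_mon.
  by rewrite nf_XY subrr.
- rewrite XY_mon weightB; apply/eqP; rewrite subr_eq0; apply/eqP.
  apply: etrans (weight_mul_mon _ _ _) _; apply: etrans _ (esym (weight_mon_mul _ _ _)).
  apply: eq_weight => u.
  congr (F (_, _)); first exact: addrC.
  rewrite -[RHS]reduce_cat (reduce_catV u (false, i, f)).
  exact/(@pushK _ (false, i, f))/reduced_reduce.
- exact: weight0.
- by rewrite weightD IHx IHy addr0.
- elim/malg_ind: a => [|b m a IHa]; first by rewrite mul0r weight0.
  rewrite mulrDl; apply: etrans (weightD _ _ _) _.
  apply: etrans (congr2 +%R _ IHa) (addr0 0).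
  by rewrite weight_mull IHx mulr0.
- elim/malg_ind: a => [|b m a IHa]; first by rewrite mulr0 weight0.
  rewrite mulrDr; apply: etrans (weightD _ _ _) _.
  apply: etrans (congr2 +%R _ IHa) (addr0 0).
  by rewrite weight_mulr IHx mulr0.
Qed.

Lemma ydeg_addI u : injective (fun d => ydeg u + d).
Proof.
move=> d d' /ffunP E; apply/ffunP => i.
by move: (E i); rewrite ![(_ + _ : {ffun V -> nat}) _]ffunE => /addnI.
Qed.

Definition coef c (C : cls) : rat := weight (fun C' => (C' == C)%:R) c.

Definition classes c : seq cls := undup [seq nf m | m : {fmonom gen} <- msupp c].

Lemma coefE c C : coef c C = \sum_(m <- msupp c | nf m == C) c@_m.
Proof.
rewrite /coef /weight mmapE [RHS]big_mkcond /=; apply: eq_bigr => m _.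
by case: ifP => _; rewrite ?mulr1 ?mulr0.
Qed.

Lemma coef_unreduced c d w : ~~ reduced w -> coef c (d, w) = 0.
Proof.
move=> nrw; apply: weight_cst0 => u; case: eqP => // -[_ uw].
by rewrite -uw reduced_reduce in nrw.
Qed.

Lemma coef_large c : exists n, forall d w, (n < size w)%N -> coef c (d, w) = 0.
Proof.
exists (\sum_(m <- msupp c) size (reduce m))%N => d w nw.
rewrite coefE big_seq_cond big1 // => m /andP[mc /eqP[_ mw]].
move: nw; rewrite (big_rem m) //= mw ltnNge => /negP[].
exact: leq_addr.
Qed.

(* Conjugating by a letter that does not cancel makes a reduced word longer. *)
Lemma coef_conj c d w : central c -> reduced w -> w != [::] ->
  exists d' w', size w' = (size w).+2 /\ coef c (d, w) = coef c (d', w').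
Proof.
move=> cc rw w0.
have [g [rgw rgwg]] : exists g,
    reduced (g :: w) /\ reduced (rcons (g :: w) (inv_gen g)).
  case: w rw w0 => // h w rw _.
  suff [g [gh gl]] : exists g, h != inv_gen g /\ g != last h w.
    exists g; rewrite /reduced /= gh; split=> //.
    rewrite rcons_path (rw : path _ h w) /=; apply: contra gl => /eqP.
    by move/(can_inj (@inv_genK V)) <-.
  (* The letter must neither cancel the first letter [h] nor equal the last one. If [h] itself is
     last, the other superscript of the same node does: one node already gives a free group of rank
     two. *)
  exists (if h == last h w then (h.1.1, h.1.2, ~~ h.2) else h).
  case: ifP => [/eqP <- | /negbT hl]; last by rewrite eq_sym inv_gen_neq.
  split; first by case: h {rw} => [[[] i] f].
  by apply/eqP => /(congr1 snd) /=; case: (h.2).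
exists d, (rcons (g :: w) (inv_gen g)); split; first by rewrite size_rcons.
(* The commutator of c and g has coefficient 0 at the class of g w. In g c this class comes from w,
   in c g from g w g^-1. *)
have := weight_ideal (fun C => (C == (ydeg [:: g] + d, g :: w))%:R) (cc (mon [:: g])).
rewrite weightB => /eqP; rewrite subr_eq0 => /eqP.
move/(etrans (esym (weight_mon_mul _ _ _))) => /esym.
move/(etrans (esym (weight_mul_mon _ _ _))) => /esym E.
transitivity (weight (fun C => ((ydeg [:: g] + C.1, reduce_onto C.2 [:: g])
                                  == (ydeg [:: g] + d, g :: w))%:R) c).
  apply: eq_weight => u; congr (nat_of_bool _)%:R; rewrite /nf !xpair_eqE.
  congr andb; first by apply/eqP/eqP => [->|/ydeg_addI].
  have pw : push g w = g :: w.
    by case: (w) rgw => //= h w' /andP[/negPf->].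
  rewrite /= -pw; apply/eqP/eqP => [->//|]; apply: push_inj => //=.
  exact: reduced_reduce.
rewrite -E; apply: eq_weight => u; congr (nat_of_bool _)%:R; rewrite /nf !xpair_eqE.
congr andb; first by rewrite addrC; apply/eqP/eqP => [/ydeg_addI|->].
rewrite /= -(reduce_cat u [:: g]).
apply/eqP/eqP => [ug | uE].
  have e : reduce (u ++ [:: g]) = reduce (g :: w) by rewrite ug reduce_id.
  rewrite -(reduce_catV u g) -[[:: g; _]]/([:: g] ++ [:: inv_gen g]) catA.
  by rewrite (reduce_catr _ e) cats1 reduce_id.
have -> : reduce (u ++ [:: g]) = reduce (rcons (g :: w) (inv_gen g) ++ [:: g]).
  by apply: reduce_catr; rewrite uE reduce_id.
have := reduce_catV (g :: w) (inv_gen g); rewrite inv_genK -cats1 -catA => ->.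
exact: reduce_id.
Qed.

(** By [coef_conj] a nonzero coefficient at a nonempty word would reappear at arbitrarily long
    words, against the finite support of [c]. *)
Lemma coef_central c d w : central c -> w != [::] -> coef c (d, w) = 0.
Proof.
move=> cc; have [n large] := coef_large c.
have [k] := ubnP (n.+1 - size w); elim: k d w => // k IHk d w nk w0.
have [nw | wn] := ltnP n (size w); first exact: large.
have [rw | /coef_unreduced-> //] := boolP (reduced w).
have [d' [w' [sw' ->]]] := coef_conj d cc rw w0.
apply: IHk; last by rewrite -size_eq0 sw'.
by rewrite sw'; move: nk wn; lia.
Qed.

(** If all coefficients vanish, grouping the monomials of [c] by normal form shows that [c] is zero
    modulo the defects, hence nilpotent. So some coefficient is nonzero, and by centrality it sits
    at the empty word. *)
Lemma coef_neq0 c : inverted c -> exists d, coef c (d, [::]) != 0.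
Proof.
move=> [cc nnc].
have [/hasP[[d w] _] | /hasPn c0] := boolP (has (fun C => coef c C != 0) (classes c)).
  have [-> | w0] := eqVneq w [::]; first by exists d.
  by rewrite coef_central ?eqxx.
case: nnc; apply: defect_rel_nilpotent.
pose r := [seq (m : seq gen) | m : {fmonom gen} <- msupp c].
(* One word of the support is chosen in each class; all other words of the class are congruent to it
   by [mon_eqmod]. *)
pose rep C := nth [::] r (index C (map nf r)).
have rep_nf (m : {fmonom gen}) : m \in msupp c -> nf (rep (nf m)) = nf m.
  move=> mc; have mr : nf m \in map nf r by rewrite -map_comp; apply: map_f.
  by rewrite -(nth_map _ (nf [::])) ?nth_index // -(size_map nf) index_mem.
apply: (@eqmod_ideal _ _ _ (\sum_(m <- msupp c) (c@_m)%:MP * mon (rep (nf m)))).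
  rewrite {1}[c]monalgE; apply: eqmod_sum => m mc.
  rewrite malgUZ -mul_malgC mon_fmonom; apply: eqmodM (eqmod_refl _ _) _.
  have [degm redm] := rep_nf m mc.
  by apply: mon_eqmod.
rewrite (sum_by_class _ (fun m : {fmonom gen} => nf m)) big_seq big1 => [|C Cc].
  exact: ideal_zero.
transitivity ((coef c C)%:MP * mon (rep C)).
  rewrite coefE raddf_sum /= mulr_suml; apply: eq_bigr => m /eqP <- //.
by move: (c0 C Cc); rewrite negbK => /eqP ->; rewrite malgC0E mul0r.
Qed.

End CentralElements.

(** * Finite groups as models of the localized algebra *)

Section RegularMatrices.
Variables (gT : finGroupType) (K : fieldType) (m : nat).
Variables (e : 'I_m.+1 -> gT) (e' : gT -> 'I_m.+1).
Hypotheses (eK : cancel e e') (e'K : cancel e' e).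

(** The right regular representation, by permutation matrices acting on row vectors. *)
Definition reg (a : gT) : 'M[K]_m.+1 := \matrix_(i, j) ((e i * a)%g == e j)%:R.

Lemma reg1 : reg 1%g = 1.
Proof.
by apply/matrixP => i j; rewrite !mxE mulg1 (inj_eq (can_inj eK)).
Qed.

Lemma regM a b : reg (a * b)%g = reg a * reg b.
Proof.
apply/matrixP => i k; rewrite !mxE (bigD1 (e' (e i * a)%g)) //= !mxE e'K eqxx mul1r.
rewrite big1 ?addr0 ?mulgA // => j; rewrite !mxE => /negPf ij.
case: eqP => [eij | _]; last by rewrite mul0r.
by rewrite eij eK eqxx in ij.
Qed.

Lemma reg_inj : injective reg.
Proof.
move=> a b /matrixP /(_ (e' 1%g) (e' a)); rewrite !mxE !e'K !mul1g eqxx.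
by case: eqP => [-> | _ /eqP] //; rewrite oner_eq0.
Qed.

End RegularMatrices.

Section Representation.
Variables (V : finType) (gT : finGroupType) (theta : V -> bool -> gT).
Local Notation gen := (gen V).
Local Notation P := (mpoly #|V| rat).
Local Notation K := {fraction P}.
Implicit Types (u v : seq gen) (d : {ffun V -> nat}) (g : gen).

Definition letter_val g : gT :=
  if g.1.1 then ((theta g.1.2 (~~ g.2))^-1)%g else theta g.1.2 g.2.

Definition word_val u : gT := (\prod_(g <- u) letter_val g)%g.

Lemma letter_valV g : letter_val (inv_gen g) = ((letter_val g)^-1)%g.
Proof. by case: g => [[[] i] f]; rewrite /letter_val /= ?negbK ?invgK. Qed.

Lemma word_val_reduce u : word_val (reduce u) = word_val u.
Proof.
elim: u => //= g u; rewrite /word_val big_cons => <-.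
rewrite /reduce /= -/(reduce u); case: (reduce u) => [|h w] /=.
  by rewrite big_seq1 big_nil mulg1.
case: eqP => [-> | _]; rewrite !big_cons //.
by rewrite letter_valV mulKVg.
Qed.

Definition ymnm d : multinom #|V| := Multinom [tuple d (enum_val i) | i < #|V|].

Definition ymon d : P := mpolyX rat (ymnm d).

Lemma ymonD d d' : ymon (d + d') = ymon d * ymon d'.
Proof.
rewrite /ymon -mpolyXD; congr (mpolyX _ _); apply/mnmP => i.
by rewrite mnmDE !mnmE ffunE.
Qed.

Lemma ymon_neq0 d : ymon d != 0.
Proof.
apply/eqP => /(congr1 (mpoly.mcoeff (ymnm d))) /eqP.
by rewrite mcoeffX eqxx mpoly.mcoeff0 oner_eq0.
Qed.

Lemma ymnm_inj : injective ymnm.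
Proof.
move=> d d' /mnmP dd'; apply/ffunP => i.
by have := dd' (enum_rank i); rewrite !mnmE enum_rankK.
Qed.

Variables (m : nat) (e : 'I_m.+1 -> gT) (e' : gT -> 'I_m.+1).
Hypotheses (eK : cancel e e') (e'K : cancel e' e).

Local Notation R := 'M[K]_m.+1.
Local Notation rg := (reg K e).

Definition ratK : {rmorphism rat -> K} := (@tofrac P \o @mpolyC #|V| rat).

(* X_i^(f) acts as theta i f and Y_i^(f) as N_i (theta i (f + 1))^-1, where the N_i
   are the indeterminates of K. *)
Definition rep g : R := tofrac (ymon (ydeg [:: g])) *: rg (letter_val g).

Local Notation "x %:F" := (tofrac x).
Local Notation ev := (eval ratK rep).

Lemma rep_word u : \prod_(g <- u) rep g = (ymon (ydeg u))%:F *: rg (word_val u).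
Proof.
elim: u => [|g u IHu].
  rewrite big_nil /word_val big_nil (reg1 _ eK).
  have -> : ymon (ydeg [::]) = 1.
    rewrite /ymon -mpolyX0; congr (mpolyX _ _); apply/mnmP => i.
    by rewrite mnm0E mnmE ffunE.
  by rewrite rmorph1 scale1r.
rewrite big_cons IHu /rep -scalerAl -scalerAr scalerA -rmorphM /= -ymonD -ydeg_cat.
by rewrite -(regM _ eK e'K) /word_val big_cons.
Qed.

Lemma ev_mon u : ev (mon u) = (ymon (ydeg u))%:F *: rg (word_val u).
Proof. by rewrite eval_mon rep_word. Qed.

Lemma ev_mon_nf u v : nf u = nf v -> ev (mon u) = ev (mon v).
Proof.
by move=> [deguv reduv]; rewrite !ev_mon deguv -word_val_reduce reduv word_val_reduce.
Qed.

Lemma ev_mon_inj u v : ydeg u = ydeg v ->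
  ev (mon u) = ev (mon v) -> word_val u = word_val v.
Proof.
move=> deguv; rewrite !ev_mon deguv => /scalerI E.
apply: (reg_inj e'K); apply: E; rewrite tofrac_eq0.
exact: ymon_neq0.
Qed.

Lemma ev_quiver x : quiver_rel x -> ev x = 0.
Proof.
case=> {x} [i f | i f a]; rewrite XY_mon ?YX_mon rmorphB /=.
  by rewrite (ev_mon_nf (nf_XY i f)) subrr.
have evM x y : ev (x * y) = ev x * ev y by apply: rmorphM.
apply/eqP; rewrite subr_eq0; apply/eqP; apply: etrans (evM _ _) _.
apply: etrans _ (esym (evM _ _)); rewrite ev_mon.
have -> : word_val [:: (false, i, f); (true, i, ~~ f)] = 1%g.
  by rewrite -word_val_reduce (reduce_pair _ [::]) /word_val big_nil.
by rewrite (reg1 _ eK) -scalerAl -scalerAr mul1r mulr1.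
Qed.

(** Only classes with empty reduced word contribute, so the value is the scalar [p], a polynomial in
    the N_i. Different [ydeg] give different monomials, so a nonzero coefficient of [c] survives as
    a coefficient of [p]. *)
Lemma ev_inverted c : inverted c -> exists2 k : K, k != 0 & ev c = k%:A.
Proof.
move=> cinv; have [d0 cd0] := coef_neq0 cinv.
have cC : (d0, [::]) \in classes c.
  apply: contraNT cd0 => nC; rewrite coefE big_seq_cond big1 // => u /andP[uc /eqP uC].
  by case/negP: nC; rewrite mem_undup -uC; apply: map_f.
have coef0 C : C.2 != [::] -> coef c C = 0.
  by case: C => d w; apply: coef_central; case: cinv.
pose p : P := \sum_(C <- classes c) coef c C *: ymon C.1.
exists p%:F.
  rewrite tofrac_eq0; apply: contraNneq cd0.
  move=> /(congr1 (mpoly.mcoeff (ymnm d0))); rewrite mpoly.mcoeff0 => <-.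
  rewrite /p raddf_sum /= (bigD1_seq (d0, [::])) ?undup_uniq //= big1.
    by rewrite addr0 mpoly.mcoeffZ mcoeffX eqxx mulr1.
  move=> [d w]; rewrite xpair_eqE negb_and mpoly.mcoeffZ mcoeffX (inj_eq ymnm_inj) /=.
  by case/orP => [/negPf-> | w0]; rewrite ?mulr0 // coef0 ?mul0r.
pose G C := tofrac (ymon C.1) *: rg (word_val C.2).
transitivity (\sum_(C <- classes c) ratK (coef c C) *: G C).
  rewrite evalE (sum_by_class _ (fun u : {fmonom gen} => nf u)).
  apply: eq_bigr => C _; rewrite coefE raddf_sum scaler_suml.
  by apply: eq_bigr => u /eqP <-; rewrite rep_word /G /= word_val_reduce.
rewrite /p raddf_sum scaler_suml /=; apply: eq_bigr => -[d w] _.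
have [-> | w0] := eqVneq w [::].
  rewrite /G /= /word_val big_nil (reg1 _ eK).
  by rewrite -mul_mpolyC rmorphM /= -scalerA.
have -> : coef c (d, w) = 0 by apply: coef0.
by rewrite rmorph0 2!scale0r tofrac0 scale0r.
Qed.

(** Being inverted is decided classically. The value 0 in the other case is forced by [loc_junk]. *)
Definition loc_rep (l : loc_gen V) : R :=
  match l with
  | inl g => rep g
  | inr c => if excluded_middle_informative (inverted c) then (ev c)^-1 else 0
  end.

Local Notation lev := (eval ratK loc_rep).

Lemma lev_to_loc x : lev (to_loc x) = ev x.
Proof.
rewrite /to_loc raddf_sum evalE; apply: eq_bigr => u _ /=.
by rewrite eval_monomZ big_map.
Qed.

Lemma lev_loc_rel z : loc_rel z -> lev z = 0.
Proof.
have lev_inv c : lev (inv_sym c) = loc_rep (inr c).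
  by rewrite /inv_sym mon_fmu eval_mon big_seq1.
have ev_unit c : inverted c -> ev c \is a GRing.unit.
  by move=> /ev_inverted[k k0 ->]; rewrite scaler_unit ?unitr1 ?unitfE.
have levB1 x y : lev (x * y - 1) = lev x * lev y - 1.
  by rewrite rmorphB /=; congr (_ - _); [apply: rmorphM | apply: rmorph1].
case=> {z} [x qx | c ci | c ci | c nci].
- by rewrite lev_to_loc ev_quiver.
- rewrite levB1 lev_to_loc lev_inv /=.
  case: excluded_middle_informative => /= [_ | /(_ ci)//].
  by rewrite divrr ?subrr ?ev_unit.
- rewrite levB1 lev_to_loc lev_inv /=.
  case: excluded_middle_informative => /= [_ | /(_ ci)//].
  by rewrite mulVr ?subrr ?ev_unit.
- by rewrite lev_inv /=; case: excluded_middle_informative => /= [/nci|].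
Qed.

(** An assignment satisfying the first relation kills the whole ideal, hence satisfies the second
    one as an equation of matrices. Equal [ydeg] on both sides gives equal nonzero scalars, which
    cancel. *)
Lemma imposing_implies_word_val (u u' v v' : seq gen) :
  ydeg u = ydeg u' -> ydeg v = ydeg v' ->
  imposing_implies (mon u) (mon u') (mon v) (mon v') ->
  word_val u = word_val u' -> word_val v = word_val v'.
Proof.
have levB x y : lev (to_loc x - to_loc y) = ev x - ev y.
  exact: etrans (rmorphB lev _ _)
    (congr2 (fun s t => s - t) (lev_to_loc x) (lev_to_loc y)).
move=> degu degv imp uu'; apply: (ev_mon_inj degv).
apply/eqP; rewrite -subr_eq0 -levB; apply/eqP/(eval_ideal _ imp) => z.
case=> [/lev_loc_rel // | ->].
by rewrite levB (ev_mon u) (ev_mon u') degu uu' subrr.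
Qed.

End Representation.

(** * Word relations in finite groups *)

Section WordRelations.
Variable V : finType.
Local Notation gen := (gen V).
Implicit Types (g h : gen) (u v w : seq gen) (i k : V).

(** [bar] is [inv_gen] composed with [flip]. It is the exchange of X and Y undergone by a letter
    that crosses the end of a relation word, see [holds_rot]. *)
Definition bar g : gen := (~~ g.1.1, g.1.2, g.2).
Definition flip g : gen := (g.1.1, g.1.2, ~~ g.2).
Definition mirror u : seq gen := rev (map flip u).
Definition gnode g : V := g.1.2.

Lemma barK : involutive bar.
Proof. by case=> [[y i] f]; rewrite /bar /= negbK. Qed.

Lemma map_barK : involutive (map bar).
Proof. by move=> u; rewrite -map_comp map_id_in // => g _; apply: barK. Qed.

Lemma ydeg_mirror u : ydeg (mirror u) = ydeg u.
Proof. by apply/ffunP => i; rewrite !ffunE /mirror count_rev count_map. Qed.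

Lemma word_val_cat (gT : finGroupType) (theta : V -> bool -> gT) u v :
  word_val theta (u ++ v) = (word_val theta u * word_val theta v)%g.
Proof. by rewrite /word_val big_cat. Qed.

Lemma word_val_cons (gT : finGroupType) (theta : V -> bool -> gT) g v :
  word_val theta (g :: v) = (letter_val theta g * word_val theta v)%g.
Proof. by rewrite /word_val big_cons. Qed.

Lemma word_val_nil (gT : finGroupType) (theta : V -> bool -> gT) :
  word_val theta [::] = 1%g.
Proof. by rewrite /word_val big_nil. Qed.

Lemma word_val_bar (gT : finGroupType) (theta : V -> bool -> gT) u :
  word_val theta (map bar u) = ((word_val theta (mirror u))^-1)%g.
Proof.
elim: u => [|g u IHu]; first by rewrite !word_val_nil invg1.
rewrite /= word_val_cons IHu /mirror /= rev_cons -cats1 word_val_cat invMg.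
congr (_ * _)%g; rewrite word_val_cons word_val_nil mulg1 -letter_valV.
by case: g => [[y i] f]; rewrite /inv_gen /= negbK.
Qed.

Lemma eq_word_val (gT : finGroupType) (theta theta' : V -> bool -> gT) u :
  {in u, letter_val theta =1 letter_val theta'} ->
  word_val theta u = word_val theta' u.
Proof. exact: eq_big_seq. Qed.

Lemma word_val_pow (gT : finGroupType) (theta : V -> bool -> gT) (b : gT) k u :
  {in u, forall g, letter_val theta g = if gnode g == k then b else 1%g} ->
  word_val theta u = (b ^+ count (fun g => gnode g == k) u)%g.
Proof.
elim: u => [|g u IHu] ub; first by rewrite word_val_nil.
rewrite word_val_cons IHu /= => [|h hu]; last by apply: ub; rewrite inE hu orbT.
by rewrite ub ?mem_head //; case: eqP => _; rewrite ?mul1g // add1n expgS.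
Qed.

Definition holds (gT : finGroupType) (theta : V -> bool -> gT) w : Prop :=
  word_val theta w = word_val theta (mirror w).

Definition entails w w' : Prop :=
  forall (gT : finGroupType) (theta : V -> bool -> gT), holds theta w -> holds theta w'.

Lemma holdsE (gT : finGroupType) (theta : V -> bool -> gT) w :
  holds theta w <-> word_val theta (w ++ map bar w) = 1%g.
Proof.
rewrite /holds word_val_cat word_val_bar.
by split=> [->|/eqP]; rewrite ?mulgV // -eq_mulgV1 => /eqP.
Qed.

(** By [holdsE] the two relations read u v bar(u) bar(v) = 1 and v bar(u) bar(v) u = 1, which are
    conjugate. *)
Lemma holds_rot (gT : finGroupType) (theta : V -> bool -> gT) u v :
  holds theta (u ++ v) <-> holds theta (v ++ map bar u).
Proof.
rewrite !holdsE !map_cat map_barK catA !word_val_cat -!mulgA.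
split=> [/eqP | uv1].
  by rewrite -eq_invg_mul !mulgA => /eqP <-; rewrite mulVg.
set x := (X in (_ * X)%g); suff -> : x = ((word_val theta u)^-1)%g by rewrite mulgV.
by apply: (mulIg (word_val theta u)); rewrite mulVg /x -!mulgA.
Qed.

Lemma holds_bar (gT : finGroupType) (theta : V -> bool -> gT) u :
  holds theta (map bar u) <-> holds theta u.
Proof. by have := holds_rot theta u [::]; rewrite cats0 => -[? ?]; split. Qed.

End WordRelations.

Lemma perm_iter (T : finType) (s : {perm T}) n x : (s ^+ n)%g x = iter n s x.
Proof. by rewrite permX. Qed.

(* In the wreath product acting on Z/p x Z/(l+2), [a] shifts the first factor and
   [t] shifts the second one over 0 only. *)
Lemma torsion_noncommuting p l : (1 < p)%N -> (0 < l)%N ->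
  exists (gT : finGroupType) (a t : gT),
    (a ^+ p = 1)%g /\ (a * t ^+ l <> t ^+ l * a)%g.
Proof.
case: p => [|[|p]] // _ l0; pose T : finType := ('Z_p.+2 * 'Z_l.+2)%type.
pose fa (x : T) : T := (x.1 + 1, x.2).
pose ft (x : T) : T := (x.1, if x.1 == 0 then x.2 + 1 else x.2).
have fa_inj : injective fa.
  move=> [x y] [x' y'] E; have E1 : x + 1 = x' + 1 := congr1 fst E.
  have E2 : y = y' := congr1 snd E.
  by rewrite (addIr _ E1) E2.
have ft_inj : injective ft.
  move=> [x y] [x' y'] E; have xx' : x = x' := congr1 fst E; rewrite {}xx' in E *.
  have := congr1 snd E; rewrite /ft [(x', y).1]/= [(x', y').1]/=.
  by case: (x' == 0) => [/addIr|] /= ->.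
exists {perm T}, (perm fa_inj), (perm ft_inj); split.
  apply/permP => x; rewrite perm_iter perm1.
  have -> n : iter n (perm fa_inj) x = (x.1 + n%:R, x.2).
    elim: n => [|n IHn]; first by rewrite addr0; case: x.
    by rewrite iterS IHn permE /fa /= -addrA -natr1.
  by rewrite pchar_Zp // addr0; case: x.
have t_iter n y : iter n (perm ft_inj) (0, y) = (0, y + n%:R).
  elim: n => [|n IHn]; first by rewrite addr0.
  by rewrite iterS IHn permE /ft /= -addrA -natr1.
have t_fix n : iter n (perm ft_inj) (-1, 0) = (-1, 0).
  by elim: n => // n IHn; rewrite iterS IHn permE /ft /= oppr_eq0 oner_eq0.
(* At (-1, 0) the product a t^l first moves to (0, 0) and then to (0, l), whereas t^l a fixes the
   point first and ends at (0, 0). The modulus l + 2 keeps l different from 0. *)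
move=> /permP/(_ (-1, 0)); rewrite !permM !perm_iter t_fix !permE /fa /= addNr t_iter.
move/(congr1 snd); rewrite [LHS]/= [RHS]/= add0r Zp_nat => /(congr1 val).
rewrite /= modn_small ?(ltnW (ltnSn _)) // => l_0.
by rewrite l_0 in l0.
Qed.

(** If z moves x, the transposition of z x with the third point fixes x but not z x, so it does not
    commute with z. *)
Lemma S3_center (z : 'S_3) : (forall t, commute t z) -> z = 1%g.
Proof.
move=> zC; apply/permP => x; rewrite perm1; apply/eqP/negPn/negP => zx.
have [w] : exists w, w \notin [:: x; z x].
  apply/existsP; rewrite -[[exists _, _]]negbK negb_exists.
  apply/negP => /forallP cover.
  have : (#|'I_3| <= size [:: x; z x])%N.
    rewrite -(card_uniqP _) /= ?inE ?andbT 1?eq_sym //.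
    by apply/subset_leq_card/subsetP => w _; move: (cover w); rewrite negbK.
  by rewrite card_ord.
rewrite !inE negb_or => /andP[wx wzx].
have := zC (tperm (z x) w) => /permP/(_ x); rewrite !permM.
rewrite tpermD // 1?eq_sym // tpermL => zxw.
by rewrite zxw eqxx in wzx.
Qed.

Lemma S3_noncommuting : exists a b : 'S_3,
  [/\ (a * b != b * a)%g, a^-1%g = a & b^-1%g = b].
Proof.
have [x [y [z [xy yz xz]]]] : exists x y z : 'I_3, [/\ x != y, y != z & x != z].
  by exists (inord 0), (inord 1), (inord 2); rewrite -!val_eqE /= !inordK.
exists (tperm x y), (tperm y z); split; [apply/eqP | exact: tpermV..].
move=> /permP/(_ x); rewrite !permM.
rewrite !tpermL [tperm y z x]tpermD 1?eq_sym // tpermL => zy.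
by rewrite zy eqxx in yz.
Qed.

Section WordEntailment.
Variable V : finType.
Local Notation gen := (gen V).
Implicit Types (g h : gen) (u v w A C : seq gen) (i k : V).

(** This excludes repeated nodes in an angle. If k occurs p > 1 times in [A], giving it a value a
    with a^p = 1 makes the first relation trivial for every value t of i. The second relation then
    forces a to commute with t^l, where l > 0 counts the letters of i in [C]. *)
Lemma entails_count_le1 i f k e y y' A C :
  {in A, forall g, gnode g != i} -> {in C, forall g, gnode g != k} ->
  {in A, forall g, gnode g = k -> g.1.1 = y} ->
  {in C, forall g, gnode g = i -> g.1.1 = y'} ->
  i != k -> i \in map (@gnode V) C ->
  entails ((false, i, f) :: A) ((false, k, e) :: C) ->
  (count (fun g => gnode g == k) A <= 1)%N.
Proof.
move=> Ai Ck Ay Cy ik iC imp; rewrite leqNgt; apply/negP => p2.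
have l0 : (0 < count (fun g => gnode g == i) C)%N.
  rewrite -has_count; case/mapP: iC => g gC gi; apply/hasP; exists g => //.
  by rewrite gi.
(* Assignments that do not depend on the side: all letters of node k become a
   torsion element, those of node i some t, and all the others trivial. *)
have [gT [a [t [ap na]]]] := torsion_noncommuting p2 l0.
pose theta j (_ : bool) := if j == i then t else if j == k then a else 1%g.
have flip_val g : letter_val theta (flip g) = letter_val theta g by [].
have mirror_mem u g : g \in mirror u -> exists2 g', g' \in u & g = flip g'.
  by rewrite mem_rev => /mapP.
have count_mirror u (P : pred V) :
    count (fun g => P (gnode g)) (mirror u) = count (fun g => P (gnode g)) u.
  by rewrite /mirror count_rev count_map.
have valA u : {in u, forall g, exists2 g', g' \in A & g = g' \/ g = flip g'} ->
  word_val theta u = ((if y then a^-1 else a) ^+ count (fun g => gnode g == k) u)%g.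
  move=> uA; apply: word_val_pow => g /uA[g' g'A gg'].
  have -> : letter_val theta g = letter_val theta g' by case: gg' => ->.
  have -> : gnode g = gnode g' by case: gg' => ->.
  rewrite /letter_val /theta (negPf (Ai _ g'A)); case: eqP => [/(Ay _ g'A) -> // | _].
  by rewrite invg1 if_same.
have valC u : {in u, forall g, exists2 g', g' \in C & g = g' \/ g = flip g'} ->
  word_val theta u = ((if y' then t^-1 else t) ^+ count (fun g => gnode g == i) u)%g.
  move=> uC; apply: word_val_pow => g /uC[g' g'C gg'].
  have -> : letter_val theta g = letter_val theta g' by case: gg' => ->.
  have -> : gnode g = gnode g' by case: gg' => ->.
  rewrite /letter_val /theta; case: eqP => [/(Cy _ g'C) -> // | _].
  by rewrite (negPf (Ck _ g'C)) invg1 if_same.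
have refl u : {in u, forall g, exists2 g', g' \in u & g = g' \/ g = flip g'}.
  by move=> g gu; exists g => //; left.
have mirr u : {in mirror u, forall g, exists2 g', g' \in u & g = g' \/ g = flip g'}.
  by move=> g /mirror_mem[g' g'u gg']; exists g' => //; right.
have mirror_cons g u : mirror (g :: u) = rcons (mirror u) (flip g).
  by rewrite /mirror /= rev_cons.
have := imp gT theta; rewrite /holds !mirror_cons -!cats1.
rewrite !word_val_cat !word_val_cons !word_val_nil !mulg1.
rewrite !(valA _ (refl _)) !(valA _ (mirr _)) !(valC _ (refl _)) !(valC _ (mirr _)).
rewrite !(count_mirror _ (pred1 _)).
set p := count _ A; set l := count _ C.
have -> : ((if y then a^-1 else a) ^+ p = 1)%g.
  by case: y {Ay valA}; rewrite ?expVgn ap ?invg1.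
have ki : (k == i) = false by rewrite eq_sym (negPf ik).
rewrite /letter_val /theta /= ki !eqxx.
rewrite mulg1 mul1g => /(_ erefl) at_eq; apply: na.
case: y' {Cy valC} at_eq => //; rewrite expVgn => /commuteV.
by rewrite invgK.
Qed.

(* The first relation is solved for X_i^(f), with X_i^(f+1) = t arbitrary. *)
Lemma entails_central i f A A' (gT : finGroupType) (theta : V -> bool -> gT) t :
  {in A, forall g, gnode g != i} -> {in A', forall g, gnode g != i} ->
  entails ((false, i, f) :: A) ((false, i, f) :: A') ->
  commute t ((word_val theta A)^-1 * word_val theta A')%g.
Proof.
move=> Ai A'i imp.
pose s u := word_val theta u; pose s' u := word_val theta (mirror u).
(* The relation reads X_i^(f) A = mirror(A) X_i^(f+1). With X_i^(f+1) = x it is solved by this value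
   of X_i^(f), since [A] does not involve i. *)
pose theta' x k e :=
  if k == i then if e == f then (s' A * x * (s A)^-1)%g else x else theta k e.
have theta'E x u : {in u, forall g, gnode g != i} -> word_val (theta' x) u = s u.
  move=> ui; apply: eq_word_val => g /ui gi.
  by rewrite /letter_val /theta' (negPf gi).
have theta'M x u : {in u, forall g, gnode g != i} ->
    word_val (theta' x) (mirror u) = s' u.
  move=> ui; apply: theta'E => g; rewrite mem_rev => /mapP[g' g'u ->].
  exact: ui g' g'u.
have holdsE' x u : {in u, forall g, gnode g != i} ->
    holds (theta' x) ((false, i, f) :: u) <-> (s' A * x * (s A)^-1 * s u = s' u * x)%g.
  move=> ui; rewrite /holds /mirror /= rev_cons -cats1 word_val_cat !word_val_cons.
  rewrite word_val_nil mulg1 -/(mirror u) theta'E // theta'M //.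
  by rewrite /letter_val /theta' /= !eqxx; case: (f).
have key x : (s' A * x * (s A)^-1 * s A' = s' A' * x)%g.
  by apply/(holdsE' x A' A'i)/imp/(holdsE' x A Ai); rewrite mulgKV.
(* The case x = 1 expresses mirror(A') through the other words; substituted into the case x = t, it
   leaves the commutation. *)
have := key 1%g; rewrite !mulg1 -mulgA => key1.
by have := key t; rewrite -key1 -!mulgA => /mulgI; rewrite /commute -!mulgA.
Qed.

(** The assignment for which the letter [g] has value [a], its inverse letter [a^-1] and every other
    letter 1. A letter Y_i^(f) is prescribed through X_i^(f+1), whence the sum of [g.2] and
    [g.1.1]. *)
Definition letter_theta (gT : finGroupType) g (a : gT) k e : gT :=
  if (k == gnode g) && (e == g.2 (+) g.1.1) then if g.1.1 then a^-1%g else a else 1%g.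

Lemma letter_theta_val (gT : finGroupType) g (a : gT) g' :
  letter_val (letter_theta g a) g' =
    if g' == g then a else if g' == inv_gen g then a^-1%g else 1%g.
Proof.
case: g g' => [[y i] f] [[y' i'] f'].
rewrite /letter_val /letter_theta /inv_gen /gnode /=.
rewrite !xpair_eqE; have [_ | _] := eqVneq i' i; last first.
  by rewrite ?andbF ?if_same /= ?invg1 ?if_same.
by case: y y' f f' => [] [] [] [] /=; rewrite ?invgK ?invg1.
Qed.

Definition pair_theta (gT : finGroupType) g h (a b : gT) k f : gT :=
  (letter_theta g a k f * letter_theta h b k f)%g.

Lemma pair_theta_val (gT : finGroupType) g h (a b : gT) g' : gnode g != gnode h ->
  letter_val (pair_theta g h a b) g' =
    (letter_val (letter_theta g a) g' * letter_val (letter_theta h b) g')%g.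
Proof.
move=> gh; rewrite /letter_val /pair_theta; case: ifP => // _; rewrite invMg.
rewrite /letter_theta; case: (gnode g' =P gnode g) => [g'g | _].
  by rewrite /gnode in g'g gh *; rewrite g'g (negPf gh) /= invg1 mul1g mulg1.
by rewrite /gnode in gh *; case: eqP => // _; rewrite /= invg1 mulg1 mul1g.
Qed.

Lemma word_val_letter_theta (gT : finGroupType) g (a : gT) u :
  uniq (map (@gnode V) u) ->
  word_val (letter_theta g a) u =
    if g \in u then a else if inv_gen g \in u then a^-1%g else 1%g.
Proof.
elim: u => [|h u IHu] /= => [_|/andP[hu uu]]; first by rewrite word_val_nil.
have node_nin g' : gnode g' = gnode h -> g' \notin u.
  by move=> g'h; apply: contra hu => g'u; rewrite -g'h map_f.
rewrite word_val_cons IHu // letter_theta_val !inE ![h == _]eq_sym.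
have [gh | gh] := eqVneq g h.
  by rewrite (negPf (node_nin g _)) ?gh // (negPf (node_nin (inv_gen h) _)) //= mulg1.
have [gh' | gh'] := eqVneq (inv_gen g) h; rewrite /= ?mul1g //.
rewrite (negPf (node_nin g _)) ?gh' -?gh' // (negPf (node_nin (inv_gen g) _)) ?gh' //=.
by rewrite mulg1.
Qed.

Lemma pair_theta_notin (gT : finGroupType) g h (a b : gT) u : gnode g != gnode h ->
  gnode g \notin map (@gnode V) u ->
  word_val (pair_theta g h a b) u = word_val (letter_theta h b) u.
Proof.
move=> gh gu; apply: eq_word_val => g' g'u; rewrite pair_theta_val // letter_theta_val.
have g'g : gnode g != gnode g' by apply: contraNneq gu => ->; apply: map_f.
by rewrite !ifN ?mul1g //; apply: contraNneq g'g => ->.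
Qed.

(** The value of a word with distinct nodes is c, c^-1 or 1 according to whether it contains [g],
    [inv_gen g] or neither, and c differs from the other two. *)
Lemma S3_letter (c : 'S_3) g A A' : c != 1%g -> c != (c^-1)%g ->
  uniq (map (@gnode V) A) -> uniq (map (@gnode V) A') ->
  word_val (letter_theta g c) A = word_val (letter_theta g c) A' ->
  g \in A -> g \in A'.
Proof.
move=> c1 cV uA uA'; rewrite !word_val_letter_theta // => AA' gA.
move: AA'; rewrite gA; case: (g \in A') => //.
by case: ifP => _ cE; [rewrite -cE eqxx in cV | rewrite cE eqxx in c1].
Qed.

(** For noncommuting involutions a, b the product c = a b is neither 1 nor its own inverse, so
    [S3_letter] shows that both words have the same letters. The values a and b on two letters then
    detect their order. *)
Lemma S3_separates A A' :
  uniq (map (@gnode V) A) -> uniq (map (@gnode V) A') ->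
  (forall theta : V -> bool -> 'S_3, word_val theta A = word_val theta A') -> A = A'.
Proof.
have [a [b [ab aV bV]]] := S3_noncommuting; pose c := (a * b)%g.
have c1 : c != 1%g.
  apply: contra ab => /eqP ab1.
  by rewrite -/c ab1 eq_sym -(mulKg a b) -/c ab1 mulg1 mulVg.
have cV : c != (c^-1)%g by rewrite invMg aV bV.
elim: A A' => [|g A IHA] A' uA uA' AA'.
  case: A' uA' AA' => // g A' uA' /(_ (letter_theta g c)) /esym AA'.
  by have := S3_letter c1 cV uA' uA AA'; rewrite mem_head in_nil => /(_ isT).
have mem h : (h \in g :: A) = (h \in A').
  have := AA' (letter_theta h c) => E.
  by apply/idP/idP; apply: S3_letter (c1) cV _ _ _ => //; apply: esym.
have gA' : g \in A' by rewrite -mem mem_head.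
case/splitPr: gA' uA' AA' mem => p q uA' AA' mem.
have p0 : p = [::].
  case: p uA' AA' mem => // h p uA' AA' mem.
  have hA : h \in g :: A by rewrite mem mem_head.
  have gh : gnode g != gnode h.
    by move: uA'; rewrite /= map_cat mem_cat /= inE !negb_or eq_sym => /andP[/and3P[]].
  have {}hA : h \in A.
    by move: hA; rewrite inE => /predU1P[hg | //]; rewrite hg eqxx in gh.
  (* If [A'] began with another letter h, then g would precede h in one word and follow it in the
     other, giving a b = b a. *)
  move: (AA' (pair_theta g h a b)); move: uA uA' => /= /andP[gA uA].
  rewrite map_cat /= mem_cat inE cat_uniq /= !negb_or.
  case/andP=> /and3P[hp _ hq] /and3P[up /andP[gp _] /andP[gq uq]].
  rewrite -cat_cons word_val_cat !word_val_cons !pair_theta_notin // !pair_theta_val //.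
  rewrite !word_val_letter_theta // !letter_theta_val hA.
  have gnode_neq (x y : gen) : gnode x != gnode y -> (x == y) = false.
    by move=> xy; apply: contraNF xy => /eqP ->.
  have gnode_nin (x : gen) (u : seq gen) :
      gnode x \notin map (@gnode V) u -> (x \in u) = false.
    by move=> xu; apply: contraNF xu; apply: map_f.
  have hg : gnode h != gnode g by rewrite eq_sym.
  rewrite !eqxx (gnode_neq g h) // (gnode_neq h g) //.
  rewrite (gnode_neq g (inv_gen h)) // (gnode_neq h (inv_gen g)) //.
  rewrite !(gnode_nin h) // !(gnode_nin (inv_gen h)) // !mulg1 !mul1g => E.
  by rewrite E eqxx in ab.
rewrite p0 in uA' AA' mem *; congr (_ :: _); apply: IHA.
- by case/andP: uA.
- by case/andP: uA'.
- by move=> theta; move: (AA' theta); rewrite !word_val_cons => /mulgI.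
Qed.

(** By [entails_central] the quotient of the values of [A] and [A'] in S_3 is always central, hence
    trivial, and values in S_3 separate such words. *)
Lemma entails_eq i f A A' :
  {in A, forall g, gnode g != i} -> {in A', forall g, gnode g != i} ->
  uniq (map (@gnode V) A) -> uniq (map (@gnode V) A') ->
  entails ((false, i, f) :: A) ((false, i, f) :: A') -> A = A'.
Proof.
move=> Ai A'i uA uA' imp; apply: S3_separates => // theta.
have /S3_center /eqP : forall t,
    commute t ((word_val theta A)^-1 * word_val theta A')%g.
  by move=> t; apply: entails_central Ai A'i imp.
by rewrite -eq_mulVg1 => /eqP.
Qed.

End WordEntailment.

(** * Angles of ST-compatible quivers *)

Lemma mem_sides (T : eqType) (s : bool -> seq T) f x : uniq (s false ++ s true) ->
  (x \in s f) = (x \in s false ++ s true) && ((x \in s true) == f).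
Proof.
rewrite cat_uniq mem_cat => /and3P[_ /hasPn disj _].
have xs : x \in s true -> x \in s false = false by move/disj/negbTE.
case: f; case xs1 : (x \in s true); rewrite ?orbT ?andbT ?andbF ?orbF ?eqxx //.
by rewrite xs.
Qed.

Section AngleWords.
Variable Q : ordered_quiver.
Local Notation V := (node Q).
Implicit Types (a b : arrow Q) (i j k : V) (f e : bool) (g : gen V).

Lemma In_uniq k : uniq (In k false ++ In k true).
Proof. by rewrite (perm_uniq (InP k)) enum_uniq. Qed.

Lemma Out_uniq k : uniq (Out k false ++ Out k true).
Proof. by rewrite (perm_uniq (OutP k)) enum_uniq. Qed.

Lemma mem_InP k f a :
  reflect [/\ a \in pruned Q, tgt a = k & tside a = f] (a \in In k f).
Proof.
rewrite mem_sides ?In_uniq // (perm_mem (InP k)) mem_enum inE -andbA.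
apply: (iffP and3P) => [[ap /eqP tk /eqP af] | [ap <- <-]]; last by rewrite ap !eqxx.
by split=> //; rewrite /tside tk.
Qed.

Lemma mem_OutP k f a :
  reflect [/\ a \in pruned Q, src a = k & sside a = f] (a \in Out k f).
Proof.
rewrite mem_sides ?Out_uniq // (perm_mem (OutP k)) mem_enum inE -andbA.
apply: (iffP and3P) => [[ap /eqP tk /eqP af] | [ap <- <-]]; last by rewrite ap !eqxx.
by split=> //; rewrite /sside tk.
Qed.

(** The exponent t + 1 of sigma tau turns a parallel arrow into a letter Y and a crossing one into a
    letter X, see [angle_factorE]. *)
Definition src_letter a : gen V := (~~ color a, src a, sside a).
Definition tgt_letter a : gen V := (~~ color a, tgt a, tside a).

Definition angle_word k f : seq (gen V) :=
  map src_letter (In k f) ++ (false, k, f) :: map tgt_letter (Out k f).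

Lemma sigma_mon (w : seq (gen V)) : @sigma V (mon w) = mon (mirror w).
Proof.
rewrite /sigma /anti mon.unlock msuppU1 big_seq_fset1 mcoeffUU /mirror.
by congr << _ *g FMonom (rev _) >>; apply: eq_map => -[[y i] f].
Qed.

Lemma tau_mon (w : seq (gen V)) : @tau V (mon w) = mon (rev (map (@inv_gen V) w)).
Proof.
rewrite /tau /anti mon.unlock msuppU1 big_seq_fset1 mcoeffUU.
by congr << _ *g FMonom (rev _) >>; apply: eq_map => -[[y i] f].
Qed.

Lemma iter_sigma_letter y i e f :
  iter f (@sigma V) (mon [:: (y, i, e)]) = mon [:: (y, i, f (+) e)].
Proof. by case: f; rewrite //= sigma_mon. Qed.

Lemma angle_factorE i f t : angle_factor i f t = mon [:: (~~ t, i, f)].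
Proof.
rewrite /angle_factor X_mon.
have -> : iter t.+1 (@sigma V \o @tau V) (mon [:: (false, i, false)])
    = mon [:: (~~ t, i, false)].
  by case: t => /=; rewrite !(tau_mon, sigma_mon).
by rewrite iter_sigma_letter addbF.
Qed.

Lemma prod_mon (I : Type) (r : seq I) (F : I -> gen V) :
  \prod_(x <- r) mon [:: F x] = mon (map F r).
Proof.
elim: r => [|x r IHr]; first by rewrite big_nil mon_nil.
by rewrite big_cons IHr -mon_cat.
Qed.

Lemma angleE k f : angle k f = mon (angle_word k f).
Proof.
rewrite /angle X_mon iter_sigma_letter addbF.
under eq_bigr do rewrite angle_factorE.
under [X in _ * X]eq_bigr do rewrite angle_factorE.
by rewrite !prod_mon -!mon_cat -catA.
Qed.

Lemma angle_rel_entails k f j e :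
  angle_rel_implies k f j e -> entails (angle_word k f) (angle_word j e).
Proof.
rewrite /angle_rel_implies !angleE !sigma_mon => imp gT theta.
pose n := #|gT|.-1.
have gT_n : #|gT| = n.+1 by rewrite prednK //; apply/card_gt0P; exists 1%g.
pose e0 (x : 'I_n.+1) : gT := enum_val (cast_ord (esym gT_n) x).
pose e1 (x : gT) : 'I_n.+1 := cast_ord gT_n (enum_rank x).
have e0K : cancel e0 e1 by move=> x; rewrite /e0 /e1 enum_valK cast_ordKV.
have e1K : cancel e1 e0 by move=> x; rewrite /e0 /e1 cast_ordK enum_rankK.
by apply: (imposing_implies_word_val e0K e1K); rewrite ?ydeg_mirror.
Qed.

(* The angle word, rotated to start with the letter of k, without that letter. *)
Definition tail_word k f : seq (gen V) :=
  map tgt_letter (Out k f) ++ map (@bar V) (map src_letter (In k f)).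

Lemma holds_angle (gT : finGroupType) (theta : V -> bool -> gT) k f :
  holds theta (angle_word k f) <-> holds theta ((false, k, f) :: tail_word k f).
Proof. exact: holds_rot. Qed.

Lemma tail_wordP k f g : reflect
  (exists2 a, a \in pruned Q &
     [/\ src a = k, sside a = f & g = tgt_letter a]
     \/ [/\ tgt a = k, tside a = f & g = bar (src_letter a)])
  (g \in tail_word k f).
Proof.
rewrite mem_cat -map_comp.
apply: (iffP orP) => [[] /mapP[a]|[a ap [[ak af ->]|[ak af ->]]]].
- by move=> /mem_OutP[ap ak af] ->; exists a => //; left.
- by move=> /mem_InP[ap ak af] ->; exists a => //; right.
- by left; apply: map_f; apply/mem_OutP.
- by right; apply: (map_f (@bar V \o src_letter)); apply/mem_InP.
Qed.

Lemma tail_word_node k f : {in tail_word k f, forall g, gnode g != k}.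
Proof.
move=> g /tail_wordP[a _ [[<- _ ->]|[<- _ ->]]]; first by rewrite eq_sym no_loop.
exact: no_loop.
Qed.

(** Two letters of one node come from arrows between the same two nodes. These have one direction,
    as there are no 2-cycles, and one color, by pruning. *)
Lemma tail_word_sign k f :
  {in tail_word k f &, forall g g', gnode g = gnode g' -> g.1.1 = g'.1.1}.
Proof.
have [_ col] := prunedP Q.
move=> g g' /tail_wordP[a ap [[ak af ->]|[ak af ->]]]
  /tail_wordP[b bp [[bk bf ->]|[bk bf ->]]] /= ab.
- by rewrite (col a b) // ak bk.
- by have := no_2cycle a b; rewrite ak bk [tgt a]ab !eqxx.
- by have := no_2cycle a b; rewrite ak bk [src a]ab !eqxx.
- by rewrite (col a b) // ak bk.
Qed.

Lemma map_gnode_bar (u : seq (gen V)) :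
  map (@gnode V) (map (@bar V) u) = map (@gnode V) u.
Proof. by rewrite -map_comp. Qed.

Definition gside g : V * bool := (gnode g, g.2).

Lemma tail_word_adj k f g : g \in tail_word k f -> side_adj (k, f) (gside g).
Proof.
move=> /tail_wordP[a ap ag]; apply/existsP; exists a; rewrite ap /=.
case: ag => [[<- <- ->]|[<- <- ->]]; rewrite !eqxx ?orbT //.
Qed.

Lemma side_adjP p q : side_adj p q ->
  exists2 g, g \in tail_word p.1 p.2 & gside g = q.
Proof.
case: p q => [k f] [j e] /existsP[a /andP[ap /orP[]]] /andP[/eqP[-> ->] /eqP[-> ->]].
  by exists (tgt_letter a) => //; apply/tail_wordP; exists a => //; left.
by exists (bar (src_letter a)) => //; apply/tail_wordP; exists a => //; right.
Qed.

Lemma side_adj_sym : ssrbool.symmetric (@side_adj Q).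
Proof.
move=> p q; apply: eq_existsb => a; rewrite /= orbC.
by congr (_ && (_ || _)); apply: andbC.
Qed.

Hypothesis hQ : ST_compatible Q.

Lemma side_adj_entails k f j e : side_adj (k, f) (j, e) ->
  entails ((false, k, f) :: tail_word k f) ((false, j, e) :: tail_word j e).
Proof.
case/existsP=> a /andP[ap adj] gT theta /holds_angle kf; apply/holds_angle.
have [st ts] := hQ ap.
case/orP: adj => /andP[/eqP[ek ef] /eqP[ej ee]]; subst.
  exact: angle_rel_entails st gT theta kf.
exact: angle_rel_entails ts gT theta kf.
Qed.

(** A letter of node j makes (k, f) adjacent to a side of j, and the entailment between the two
    angle relations allows only one letter of j ([entails_count_le1]). *)
Lemma tail_word_uniq k f : uniq (map (@gnode V) (tail_word k f)).
Proof.
apply/count_mem_uniq => j.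
have [jk | /negPf jk] := boolP (j \in _); last by apply/count_memPn; rewrite jk.
apply/eqP; rewrite eqn_leq -has_count has_pred1 jk andbT count_map.
case/mapP: jk => g gk ->.
have gadj := tail_word_adj gk.
have [g' g'k g'_side] : exists2 g', g' \in tail_word (gnode g) g.2 & gside g' = (k, f).
  by rewrite side_adj_sym in gadj; apply: (side_adjP gadj).
apply: (entails_count_le1 (y := g.1.1) (y' := g'.1.1)
          (tail_word_node (f := f)) (tail_word_node (f := g.2)) _ _ _ _
          (side_adj_entails gadj)).
- by move=> h hk hg; apply: tail_word_sign hk gk hg.
- by move=> h hk hg; apply: tail_word_sign hk g'k _; rewrite hg; case: g'_side.
- by rewrite eq_sym; apply: tail_word_node gk.
- by apply/mapP; exists g' => //; case: g'_side.
Qed.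

(** The relation of (j, e) is rotated to start with the letter of k, and barred if that letter is a
    Y, so that it starts with X_k^(f). By [entails_eq] the rest is then the tail word of (k, f). *)
Lemma tail_word_rot k f j e : side_adj (k, f) (j, e) ->
  exists c1 y c2, tail_word j e = c1 ++ (y, k, f) :: c2 /\
    tail_word k f = if y then map (@bar V) c2 ++ (false, j, e) :: c1
                    else c2 ++ (true, j, e) :: map (@bar V) c1.
Proof.
move=> adj; have := adj; rewrite side_adj_sym => /side_adjP[[[y k'] f'] gj [kk' ff']].
rewrite /gnode /= in kk' ff'; subst k' f'.
case/path.splitPr Ej: {1}(tail_word j e) / gj => [c1 c2].
exists c1, y, c2; split=> //.
set w := if y then _ else _.
have w_node : map (@gnode V) w = map (@gnode V) c2 ++ j :: map (@gnode V) c1.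
  by rewrite /w; case: (y); rewrite map_cat /= ?map_gnode_bar.
have kj : k != j.
  have := tail_word_node (f := e) (k := j); rewrite Ej => /(_ (y, k, f)); apply.
  by rewrite mem_cat mem_head orbT.
have := tail_word_uniq j e; rewrite Ej map_cat /= uniq_catC /= mem_cat negb_or.
move=> /andP[/andP[k2 k1] u21].
have jnode c : {subset c <= tail_word j e} -> j \notin map (@gnode V) c.
  by move=> cj; apply/negP => /mapP[h /cj/tail_word_node hj jh]; rewrite -jh eqxx in hj.
have j1 : j \notin map (@gnode V) c1 by apply: jnode => h; rewrite Ej mem_cat => ->.
have j2 : j \notin map (@gnode V) c2.
  by apply: jnode => h; rewrite Ej mem_cat inE => ->; rewrite !orbT.
apply: (@entails_eq _ k f); first exact: tail_word_node.
- have : k \notin map (@gnode V) w by rewrite w_node mem_cat inE !negb_or k2 kj k1.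
  by move=> kw h hw; apply: contraNneq kw => <-; apply: map_f.
- exact: tail_word_uniq.
- rewrite w_node uniq_catC /= mem_cat negb_or j1 j2 /=.
  by rewrite uniq_catC.
move=> gT theta /(side_adj_entails adj); rewrite Ej -cat_cons => /holds_rot.
rewrite /w; case: (y) => //.
by move=> kw; apply/holds_bar; rewrite /= map_cat map_barK.
Qed.

End AngleWords.

(** * Cyclic orders *)

Section Rotations.
Variable T : eqType.
Implicit Types (s t u v : seq T) (x y z : T).

Definition rotates s t := exists n, t = rot n s.

Lemma rotates_refl s : rotates s s.
Proof. by exists 0; rewrite rot0. Qed.

Lemma rotates_cat u v : rotates (u ++ v) (v ++ u).
Proof. by exists (size u); rewrite rot_size_cat. Qed.

Lemma rotatesP s t : rotates s t <-> exists u v, s = u ++ v /\ t = v ++ u.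
Proof.
split=> [[n ->]|[u [v [-> ->]]]]; last exact: rotates_cat.
by exists (take n s), (drop n s); rewrite cat_take_drop.
Qed.

Lemma rotates_trans t s u : rotates s t -> rotates t u -> rotates s u.
Proof.
(* Beyond the size of the list [rot] is the identity, so both exponents may be taken small enough to
   be added. *)
have bound n (w : seq T) : exists2 m, (m <= size w)%N & rot n w = rot m w.
  have [nw | /ltnW wn] := leqP n (size w); first by exists n.
  by exists 0; rewrite // rot_oversize ?rot0.
case=> n ->; have [{}n ns ->] := bound n s => -[m ->].
have [{}m ms ->] := bound m (rot n s).
rewrite size_rot in ms; rewrite rot_add_mod //.
by eexists.
Qed.

Lemma rotates_map (U : eqType) (h : T -> U) s t :
  rotates s t -> exists n, map h t = rot n (map h s).
Proof. by case=> n ->; exists n; rewrite map_rot. Qed.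

Lemma rotates_mem s t : rotates s t -> s =i t.
Proof. by case=> n -> x; rewrite mem_rot. Qed.

Lemma rotates_index s x t : uniq s -> rotates s (x :: t) -> x :: t = rot (index x s) s.
Proof.
move=> us /rotatesP[u [v [su]]]; case: v su => [|y v] su.
  by rewrite su cats0 cat0s => <-; rewrite /= eqxx rot0.
case=> -> ->; rewrite su index_cat.
move: us; rewrite su cat_uniq /= negb_or => /and3P[_ /andP[yu _] _].
by rewrite (negPf yu) eqxx addn0 rot_size_cat.
Qed.

Variable s : seq T.
Hypothesis s_uniq : uniq s.

Definition from x := rot (index x s) s.

(** The ternary relation of the cyclic order: running through the cycle from x, one meets y before
    z. *)
Definition between x y z := (index y (from x) < index z (from x))%N.

Lemma from_rot x t : rotates s (x :: t) -> from x = x :: t.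
Proof. by move/rotates_index->. Qed.

Lemma from_split x y : x \in s -> y \in s -> y != x -> exists u v,
  [/\ from x = x :: u ++ y :: v, from y = y :: v ++ x :: u & uniq (x :: u ++ y :: v)].
Proof.
move=> xs ys yx; have fx := rot_index xs; set t := _ ++ _ in fx.
have : y \in x :: t by rewrite -fx mem_rot.
rewrite inE (negPf yx) /= => yt; case/path.splitPr: yt fx => u v fx.
have sx : rotates s (x :: u ++ y :: v) by exists (index x s); rewrite fx.
exists u, v; split; first exact: fx.
  by apply: from_rot; apply: rotates_trans sx _; apply: (rotates_cat (x :: u)).
by rewrite -[_ && _]/(uniq (x :: u ++ y :: v)) -fx rot_uniq.
Qed.

(** Write the cycle as x u y v. Both sides hold if z lies in v and fail if z lies in u. *)
Lemma between_rot x y z : x \in s -> y \in s -> z \in s ->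
  y != x -> z != x -> z != y -> between x y z = between y z x.
Proof.
move=> xs ys zs yx zx zy; have [u [v [fx fy U]]] := from_split xs ys yx.
have zuv : z \in (x :: u) ++ (y :: v).
  by have := zs; rewrite -(mem_rot (index x s)) -/(from x) fx.
rewrite /between fx fy -[x :: u ++ _]cat_cons -[y :: v ++ _]cat_cons !index_cat.
move: U; rewrite -cat_cons cat_uniq => /and3P[_ /hasPn disj _].
have yu : y \notin x :: u by apply: disj; apply: mem_head.
have xv : x \notin y :: v.
  by apply/negP => /disj; rewrite /= mem_head.
rewrite (negPf yu) (negPf xv) /= !eqxx !addn0.
move: zuv; rewrite mem_cat; have [zu _ | zu /= zv] := boolP (z \in x :: u).
  have zv : z \notin y :: v by apply/negP => /disj; rewrite /= zu.
  have zu' : (index z (x :: u) < (size u).+1)%N by rewrite index_mem.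
  rewrite (negPf zv) ltnNge ltnW //=.
  by rewrite ltnNge leq_addr.
rewrite zv; have zv' : (index z (y :: v) < (size v).+1)%N by rewrite index_mem.
by rewrite zv' /= eq_sym (negPf zy) addnS ltnS leq_addr.
Qed.

Lemma between_neg x y z : x \in s -> y \in s -> y != z ->
  ~~ between x y z -> between x z y.
Proof.
move=> xs ys yz; rewrite /between -leqNgt leq_eqVlt => /predU1P[E | //].
have y_fx : y \in from x by rewrite mem_rot.
case/eqP: yz; rewrite -(nth_index y y_fx) -E nth_index //.
by rewrite -index_mem E index_mem.
Qed.

Lemma index_prefix (s1 s2 : seq T) y z :
  z \in s1 -> (index y (s1 ++ s2) < index z (s1 ++ s2))%N -> y \in s1.
Proof.
rewrite !index_cat => zs1; rewrite zs1; case: ifP => // _.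
by rewrite ltnNge (leq_trans (ltnW _) (leq_addr _ _)) // index_mem.
Qed.

Lemma index_suffix (s1 s2 : seq T) y z : z \in s1 ++ s2 ->
  y \notin s1 -> (index y (s1 ++ s2) < index z (s1 ++ s2))%N -> z \in s2.
Proof.
rewrite mem_cat !index_cat => /orP[zs1 | //] /negPf->; rewrite zs1 ltnNge.
by rewrite (leq_trans (ltnW _) (leq_addr _ _)) // index_mem.
Qed.

End Rotations.

(** * ST-tiles *)

Lemma uniq_map_inj (T U : eqType) (h : T -> U) (s : seq T) :
  uniq (map h s) -> {in s &, injective h}.
Proof.
elim: s => // z s IHs /= /andP[hz us] x y; rewrite !inE.
case/predU1P=> [->|xs] /predU1P[->|ys] //; last exact: IHs.
  by move=> hzy; rewrite hzy map_f in hz.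
by move=> hxz; rewrite -hxz map_f in hz.
Qed.

Lemma mem_full_arrows (Q : quiver) (A : {set arrow Q}) (S : {set node Q}) a :
  (a \in full_arrows A S) = [&& a \in A, src a \in S & tgt a \in S].
Proof. by rewrite inE. Qed.

Section Tiles.
Variable Q : ordered_quiver.
Hypothesis hQ : ST_compatible Q.
Local Notation V := (node Q).
Implicit Types (a b : arrow Q) (i j k x y z : V) (f e : bool) (q : V * bool).

(** Forgetting X and Y hides the exchange at the end of the word, so adjacent node-sides have lists
    that are true rotations of each other. *)
Definition sides q : seq (V * bool) := q :: map (@gside Q) (tail_word q.1 q.2).

Lemma gside_bar (u : seq (gen V)) : map (@gside Q) (map (@bar V) u) = map (@gside Q) u.
Proof. by rewrite -map_comp. Qed.

Lemma sides_adj q q' : side_adj q q' -> rotates (sides q) (sides q').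
Proof.
case: q q' => [k f] [j e] /(tail_word_rot hQ)[c1 [y [c2 [Ej Ek]]]].
have -> : sides (k, f) = ((k, f) :: map (@gside Q) c2) ++ (j, e) :: map (@gside Q) c1.
  by rewrite /sides /= Ek; case: y {Ej Ek}; rewrite map_cat /= gside_bar.
rewrite /sides /= Ej map_cat /= -cat_cons.
exact: (rotates_cat (_ :: _)).
Qed.

Lemma sides_connect q q' : connect (@side_adj Q) q q' -> rotates (sides q) (sides q').
Proof.
case/connectP=> r; elim: r q => [|q1 r IHr] q /= => [_ ->|/andP[adj rP] rq'].
  exact: rotates_refl.
exact: rotates_trans (sides_adj adj) (IHr _ rP rq').
Qed.

Lemma sides_fst k f : map fst (sides (k, f))
  = k :: [seq tgt a | a <- Out k f] ++ [seq src a | a <- In k f].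
Proof. by rewrite /sides /tail_word /= !map_cat -!map_comp. Qed.

Lemma angle_nodes_rot k f : rotates (map fst (sides (k, f))) (angle_nodes k f).
Proof. by rewrite sides_fst -cat_cons; apply: rotates_cat. Qed.

Variable p : V * bool.
Local Notation N := (tile_nodes p).
Local Notation T := (tile_arrows p).
Local Notation s := (map fst (sides p)).

(** All node-sides reached from [p] have rotations of one list, so the closure stops after one step:
    a tile consists of [p] and its neighbours. *)
Lemma mem_tile q : (q \in tile_sides p) = (q \in sides p).
Proof.
rewrite inE; apply/idP/idP => [/sides_connect/rotates_mem -> | ].
  exact: mem_head.
rewrite inE => /predU1P[-> | /mapP[g gp ->]]; first exact: connect0.
by apply: connect1; case: (p) gp => k f; apply: tail_word_adj.
Qed.

Lemma tile_sides_rot q : q \in tile_sides p -> rotates (sides p) (sides q).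
Proof. by rewrite inE; apply: sides_connect. Qed.

Lemma tile_seq_uniq : uniq s.
Proof.
rewrite /= -map_comp [uniq _](tail_word_uniq hQ) andbT.
by apply/mapP => -[g /tail_word_node gp pg]; rewrite pg eqxx in gp.
Qed.

Lemma mem_tile_nodes : s =i N.
Proof.
move=> k; apply/mapP/imsetP => -[q qp ->]; exists q => //; first by rewrite mem_tile.
by rewrite -mem_tile.
Qed.

Lemma tile_side_unique k f e :
  (k, f) \in tile_sides p -> (k, e) \in tile_sides p -> f = e.
Proof.
rewrite !mem_tile => kf ke.
have inj := uniq_map_inj tile_seq_uniq.
by have [] := inj _ _ kf ke erefl.
Qed.

Lemma from_tile k f : (k, f) \in tile_sides p ->
  from s k = k :: [seq tgt a | a <- Out k f] ++ [seq src a | a <- In k f].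
Proof.
move=> /tile_sides_rot/rotates_map-/(_ _ fst)[n En].
by apply: (from_rot tile_seq_uniq); exists n; rewrite -sides_fst.
Qed.

Lemma tile_side k : k \in N -> exists f, (k, f) \in tile_sides p.
Proof. by case/imsetP=> -[k' f] kf ->; exists f. Qed.

Lemma tile_arrow_sides a : a \in T ->
  [/\ a \in pruned Q, (src a, sside a) \in tile_sides p
    & (tgt a, tside a) \in tile_sides p].
Proof.
rewrite inE => /andP[ap ends].
have adj : side_adj (src a, sside a) (tgt a, tside a).
  by apply/existsP; exists a; rewrite ap /= !eqxx.
suff E : ((src a, sside a) \in tile_sides p) = ((tgt a, tside a) \in tile_sides p).
  by move: ends; rewrite E orbb.
rewrite !inE; apply/idP/idP => pa; apply: connect_trans pa (connect1 _) => //.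
by rewrite side_adj_sym.
Qed.

Lemma tile_arrow_Out a k f : (k, f) \in tile_sides p ->
  (a \in Out k f) = (a \in T) && (src a == k).
Proof.
move=> kf; apply/mem_OutP/andP => [[ap ak af] | [/tile_arrow_sides[ap sp _] /eqP ak]].
  by rewrite inE ap ak af kf eqxx.
by split=> //; apply: (tile_side_unique (k := k)) kf; rewrite -ak.
Qed.

Lemma tile_arrow_In a k f : (k, f) \in tile_sides p ->
  (a \in In k f) = (a \in T) && (tgt a == k).
Proof.
move=> kf; apply/mem_InP/andP => [[ap ak af] | [/tile_arrow_sides[ap _ tp] /eqP ak]].
  by rewrite inE ap ak af kf orbT eqxx.
by split=> //; apply: (tile_side_unique (k := k)) kf; rewrite -ak.
Qed.

Lemma has_arrow_Out k f j : (k, f) \in tile_sides p ->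
  has_arrow T k j = (j \in [seq tgt a | a <- Out k f]).
Proof.
move=> kf; apply/existsP/mapP => [[a /and3P[aT ak /eqP aj]] | [a ak ->]].
  by exists a => //; rewrite (tile_arrow_Out _ kf) aT.
by exists a; move: ak; rewrite (tile_arrow_Out _ kf) => /andP[-> ->] /=.
Qed.

Lemma has_arrow_In k f j : (k, f) \in tile_sides p ->
  has_arrow T j k = (j \in [seq src a | a <- In k f]).
Proof.
move=> kf; apply/existsP/mapP => [[a /and3P[aT /eqP aj ak]] | [a ak ->]].
  by exists a => //; rewrite (tile_arrow_In _ kf) aT.
by exists a; move: ak; rewrite (tile_arrow_In _ kf) => /andP[-> ->]; rewrite eqxx.
Qed.

Lemma has_arrow_N i j : has_arrow T i j -> [/\ i \in N, j \in N & i != j].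
Proof.
case/existsP=> a /and3P[/tile_arrow_sides[_ sa ta] /eqP <- /eqP <-].
split; last exact: no_loop.
  by apply/imsetP; exists (src a, sside a).
by apply/imsetP; exists (tgt a, tside a).
Qed.

Lemma has_arrow_asym i j : has_arrow T i j -> ~~ has_arrow T j i.
Proof.
case/existsP=> a /and3P[_ /eqP ai /eqP aj].
apply/existsP => -[b /and3P[_ /eqP bj /eqP bi]].
by have := no_2cycle a b; rewrite ai aj bi bj !eqxx.
Qed.

(** Read from i, the cycle consists of i and the other ends of the arrows on one side of i, so every
    other node of the tile is such an end. *)
Lemma has_arrow_total i j : i \in N -> j \in N -> i != j ->
  has_arrow T i j || has_arrow T j i.
Proof.
move=> /tile_side[f fi] jN ij.
rewrite (has_arrow_Out _ fi) (has_arrow_In _ fi) -mem_cat.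
have : j \in from s i by rewrite mem_rot mem_tile_nodes.
by rewrite (from_tile fi) inE eq_sym (negPf ij).
Qed.

Lemma tile_arrow_inj a b :
  a \in T -> b \in T -> src a = src b -> tgt a = tgt b -> a = b.
Proof.
move=> aT bT sab tab; have [_ sa _] := tile_arrow_sides aT.
have aO : a \in Out (src a) (sside a) by rewrite (tile_arrow_Out _ sa) aT eqxx.
have bO : b \in Out (src a) (sside a) by rewrite (tile_arrow_Out _ sa) bT sab eqxx.
have /uniq_map_inj inj : uniq [seq tgt a' | a' <- Out (src a) (sside a)].
  have := rot_uniq (index (src a) s) s; rewrite tile_seq_uniq -/(from s (src a)).
  by rewrite (from_tile sa) /= cat_uniq => /and3P[_ ->].
exact: inj.
Qed.

Lemma full_arrows_pair a : a \in T -> full_arrows T [set src a; tgt a] = [set a].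
Proof.
move=> aT; apply/setP => b; rewrite mem_full_arrows in_set1 !in_set2.
apply/idP/eqP => [/andP[bT] | ->]; last by rewrite aT !eqxx orbT.
have nl := no_loop b; have n2 := no_2cycle a b.
case/andP=> /orP[] /eqP sb /orP[] /eqP tb; move: nl n2; rewrite sb tb ?eqxx //.
by move=> _ _; apply: tile_arrow_inj.
Qed.

Lemma tile_tournament : tournament N T.
Proof.
split=> [a /tile_arrow_sides[_ sa ta] | i j iN jN ij].
  by split; apply/imsetP; [exists (src a, sside a) | exists (tgt a, tside a)].
case/orP: (has_arrow_total iN jN ij) => /existsP[a /and3P[aT /eqP ai /eqP aj]].
  by rewrite -ai -aj full_arrows_pair ?cards1.
by rewrite setUC -ai -aj full_arrows_pair ?cards1.
Qed.

(* On one side of x the angle lists the targets of the outgoing arrows right after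
   x in the cyclic order, and the sources of the incoming ones right before x. *)
Lemma between_Out x y z : y \in N -> y != x ->
  between s x y z -> has_arrow T x z -> has_arrow T x y.
Proof.
move=> yN yx xyz xz; have [/tile_side[f fx] zN _] := has_arrow_N xz.
move: xyz xz; rewrite /between !(has_arrow_Out _ fx) (from_tile fx) -cat_cons => xyz xz.
have : y \in x :: [seq tgt a | a <- Out x f].
  by apply: index_prefix xyz; rewrite inE xz orbT.
by rewrite inE (negPf yx).
Qed.

Lemma between_In x y z : y \in N -> z \in N ->
  between s x y z -> has_arrow T y x -> has_arrow T z x.
Proof.
move=> yN zN xyz yx; have [_ /tile_side[f fx] _] := has_arrow_N yx.
have z_fx : z \in from s x by rewrite mem_rot mem_tile_nodes.
have := rot_uniq (index x s) s; rewrite tile_seq_uniq -/(from s x).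
move: xyz yx z_fx; rewrite /between !(has_arrow_In _ fx) (from_tile fx) -cat_cons.
move=> xyz yx z_fx; rewrite cat_uniq => /and3P[_ /hasPn disj _].
by apply: index_suffix xyz => //; apply: disj.
Qed.

Lemma tile_locally_transitive : locally_transitive_tournament N T.
Proof.
split=> [|k kN I J]; first exact: tile_tournament.
have sN x : x \in N -> x \in s by rewrite mem_tile_nodes.
(* It suffices that the arrows inside [M] follow the linear order obtained by cutting the cycle at
   k, since that order is transitive. *)
have main (M : {set V}) : M \subset N -> k \notin M ->
    {in M &, forall x y, x != y -> between s k x y -> has_arrow T x y} ->
  transitive_tournament M (full_arrows T M).
  move=> /subsetP MN kM ordM.
  have arrowM : {in M &, has_arrow (full_arrows T M) =2 has_arrow T}.
    move=> x y xM yM; apply: eq_existsb => a; rewrite mem_full_arrows -!andbA.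
    case: (a \in T) => //=; apply/and4P/andP => [[_ _ -> ->] // | [/eqP-> /eqP->]].
    by rewrite xM yM !eqxx.
  have arrow_between : {in M &, forall x y, has_arrow T x y -> between s k x y}.
    move=> x y xM yM xy; have [_ _ xNy] := has_arrow_N xy.
    apply/negPn/negP => /(between_neg (sN _ kN) (sN _ (MN _ xM)) xNy) kyx.
    by case/negP: (has_arrow_asym xy); apply: ordM; rewrite // eq_sym.
  split; first split.
  - by move=> a; rewrite mem_full_arrows => /and3P[].
  - move=> i j iM jM ij; rewrite -(proj2 tile_tournament i j (MN _ iM) (MN _ jM) ij).
    apply: eq_card => a; rewrite !mem_full_arrows !in_set2 -!andbA.
    case: (a \in T) => //=.
    apply/and4P/andP => [[] // | [sa ta]]; split=> //.
      by case/orP: sa => /eqP->.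
    by case/orP: ta => /eqP->.
  move=> y x z yM xM zM; rewrite !arrowM // => xy yz.
  have xz : between s k x z.
    exact: ltn_trans (arrow_between _ _ xM yM xy) (arrow_between _ _ yM zM yz).
  apply: ordM => //; apply: contraTneq xz => ->.
  by rewrite /between ltnn.
split; apply: main.
- by apply/subsetP => i; rewrite inE => /andP[].
- rewrite inE negb_and; apply/orP; right; apply/negP => /has_arrow_N[_ _].
  by rewrite eqxx.
- move=> x y; rewrite !inE => /andP[xN xk] /andP[yN yk] xy kxy.
  have [_ _ xNk] := has_arrow_N xk; have [_ _ yNk] := has_arrow_N yk.
  have yx : y != x by rewrite eq_sym.
  (* From x, the node y is met before the target k of an arrow from x, so y is a target as well. *)
  apply: (between_Out yN yx _ xk).
  by rewrite -(between_rot tile_seq_uniq (sN _ kN) (sN _ xN) (sN _ yN) xNk yNk yx).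
- by apply/subsetP => i; rewrite inE => /andP[].
- rewrite inE negb_and; apply/orP; right; apply/negP => /has_arrow_N[_ _].
  by rewrite eqxx.
move=> x y; rewrite !inE => /andP[xN xk] /andP[yN yk] xy kxy.
have [_ _ xNk] := has_arrow_N xk; have [_ _ yNk] := has_arrow_N yk.
rewrite eq_sym in xNk; rewrite eq_sym in yNk; rewrite eq_sym in xy.
have xNy : x != y by rewrite eq_sym.
have kNx : k != x by rewrite eq_sym.
have kNy : k != y by rewrite eq_sym.
(* From y, the node x is met after the source k of an arrow into y, so x is a source as well. *)
apply: (between_In kN xN _ yk).
rewrite -(between_rot tile_seq_uniq (sN _ xN) (sN _ yN) (sN _ kN) xy kNx kNy).
by rewrite -(between_rot tile_seq_uniq (sN _ kN) (sN _ xN) (sN _ yN) xNk yNk xy).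
Qed.

Lemma tail_letter_inj k f : {in tail_word k f &, injective (@gnode V)}.
Proof. exact: uniq_map_inj (tail_word_uniq hQ k f). Qed.

Lemma from_tail k f : (k, f) \in tile_sides p ->
  from s k = k :: map (@gnode V) (tail_word k f).
Proof. by move/from_tile->; rewrite /tail_word map_cat -!map_comp. Qed.

(** The hypothesis [between] puts k into the part [c2] of [tail_word_rot], which is barred exactly
    when the letter of i is a Y. *)
Lemma tail_letter_shift i f j e (y1 y2 : bool) k e2 : (j, e) \in tile_sides p ->
  (y1, i, f) \in tail_word j e -> (y2, k, e2) \in tail_word j e ->
  between s j i k -> (y2 (+) y1, k, e2) \in tail_word i f.
Proof.
move=> jt iw kw; have := tail_word_adj iw; rewrite side_adj_sym.
case/(tail_word_rot hQ) => c1 [y [c2 [Ej ->]]].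
have [yy1] : (y, i, f) = (y1, i, f).
  by apply: (@tail_letter_inj j e) => //; rewrite Ej mem_cat mem_head orbT.
have := rot_uniq (index j s) s; rewrite tile_seq_uniq -/(from s j).
rewrite /between (from_tail jt) Ej map_cat -cat_cons cat_uniq.
move=> /and3P[_ /hasPn/(_ i)]; rewrite mem_head => /(_ isT) i1 _.
rewrite [map _ (_ :: c2)]/= !index_cat (negPf i1) /= eqxx addn0.
move: kw; rewrite Ej mem_cat inE => /or3P[k1 | /eqP[_ -> _] | k2]; first 1 last.
- by rewrite (negPf i1) eqxx addn0 ltnn.
- rewrite yy1; case: (y1) => _; rewrite mem_cat ?addbF ?k2 //.
  by rewrite addbT (map_f (@bar V) k2).
have kc : k \in j :: map (@gnode V) c1 by rewrite inE (map_f (@gnode V) k1) orbT.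
have kl : (index k (j :: map (@gnode V) c1) <= size (j :: map (@gnode V) c1))%N.
  exact: index_size.
by rewrite kc ltnNge kl.
Qed.

Lemma tgt_letter_tail a : a \in T -> tgt_letter a \in tail_word (src a) (sside a).
Proof.
by case/tile_arrow_sides=> ap _ _; apply/tail_wordP; exists a => //; left.
Qed.

Lemma src_letter_tail a : a \in T -> bar (src_letter a) \in tail_word (tgt a) (tside a).
Proof.
by case/tile_arrow_sides=> ap _ _; apply/tail_wordP; exists a => //; right.
Qed.

(* A letter changes between X and Y when it moves across the end of the word. *)
Lemma color_shift a b g : a \in T -> b \in T -> tgt a = src b ->
  g \in tail_word (src a) (sside a) -> gnode g = tgt b ->
  between s (src a) (src b) (tgt b) -> g.1.1 (+) color a = color b.
Proof.
case: g => [[y k] e] aT bT ab; rewrite /gnode /= => kw bk; subst k => abk.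
have [_ sa ta] := tile_arrow_sides aT; have [_ sb _] := tile_arrow_sides bT.
have ss : tside a = sside b by apply: (tile_side_unique ta); rewrite ab.
have := tail_letter_shift sa (tgt_letter_tail aT) kw; rewrite ab ss => /(_ abk) kw'.
have [] := tail_letter_inj kw' (tgt_letter_tail bT) erefl.
by case: (y) (color a) (color b) => [] [] [].
Qed.

(** The direction of [c] is left open, to cover both cyclic and acyclic triangles. *)
Lemma full_arrows_triple a b c : a \in T -> b \in T -> c \in T ->
  tgt a = src b -> [set src c; tgt c] = [set src a; tgt b] ->
  full_arrows T [set src a; src b; tgt b] = [set a; b; c].
Proof.
move=> aT bT cT ab cE; apply/setP => d.
rewrite mem_full_arrows !in_setU !in_set1 -!orbA.
have cS x : (x \in [set src c; tgt c]) = (x \in [set src a; tgt b]) by rewrite cE.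
apply/and3P/or3P => [[dT sd td] | dabc].
  have pair (x : arrow Q) : x \in T ->
      src d \in [set src x; tgt x] -> tgt d \in [set src x; tgt x] -> d == x.
    by move=> xT sx tx; rewrite -in_set1 -full_arrows_pair // mem_full_arrows dT sx tx.
  have nl := no_loop d.
  have pa := pair a aT; have pb := pair b bT; have pc := pair c cT.
  rewrite !cS !in_set2 ab in pa pb pc *.
  by case/or3P: sd pa pb pc nl => /eqP->; case/or3P: td => /eqP->;
     rewrite ?eqxx ?orbT //= => pa pb pc _;
     [constructor 1; apply: pa | constructor 3; apply: pc | constructor 1; apply: pa
     | constructor 2; apply: pb | constructor 3; apply: pc | constructor 2; apply: pb].
have cs : src c \in [set src a; tgt b] by rewrite -cS set21.
have ct : tgt c \in [set src a; tgt b] by rewrite -cS set22.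
rewrite !in_set2 in cs ct.
case: dabc => /eqP->; rewrite ?aT ?bT ?cT ?ab ?eqxx ?orbT //; split=> //.
  by case/orP: cs => ->; rewrite ?orbT.
by case/orP: ct => ->; rewrite ?orbT.
Qed.

Lemma odd_num_crossing (S : {set V}) a b c :
  full_arrows T S = [set a; b; c] -> a != b -> a != c -> b != c ->
  odd (num_crossing T S) = color a (+) color b (+) color c.
Proof.
move=> E ab ac bc; rewrite /num_crossing E.
have -> : #|[set d in [set a; b; c] | color d]| = (color a + (color b + color c))%N.
  rewrite -sum1_card.
  rewrite (eq_bigl (fun d => (d \in a |: (b |: [set c])) && color d)) => [|d].
    rewrite big_mkcondr /= !big_setU1 ?inE ?negb_or ?ab // big_set1.
    by do 3 case: (color _).
  by rewrite !inE orbA.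
by rewrite !oddD !oddb addbA.
Qed.

Lemma has_arrowP i j :
  reflect (exists a, [/\ a \in T, src a = i & tgt a = j]) (has_arrow T i j).
Proof.
apply: (iffP existsP) => [[a /and3P[aT /eqP ai /eqP aj]] | [a [aT ai aj]]];
  exists a => //.
by rewrite aT ai aj !eqxx.
Qed.

Lemma arrow_neq a b : tgt a = src b -> a != b.
Proof. by move=> ab; apply/eqP => E; have := no_loop a; rewrite ab E eqxx. Qed.

(** Seen from i, the incoming arrow c gives k a letter whose Y-flag is [color c]. By [color_shift]
    the colors of a and c add up to that of b, so the number of crossings is even. *)
Lemma tile_three_cycle i j k : has_arrow T i j -> has_arrow T j k -> has_arrow T k i ->
  three_cycle T [set i; j; k].
Proof.
move=> ij jk ki; have [_ jN _] := has_arrow_N ij; have [kN iN _] := has_arrow_N ki.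
have [_ _ jNk] := has_arrow_N jk.
have sN x : x \in N -> x \in s by rewrite mem_tile_nodes.
have ijk : between s i j k.
  apply/negPn/negP => /(between_neg (sN _ iN) (sN _ jN) jNk) ikj.
  case/negP: (has_arrow_asym ki); apply: (between_Out kN _ ikj ij).
  by have [_ _] := has_arrow_N ki.
have /has_arrowP[a [aT ai aj]] := ij; have /has_arrowP[b [bT bj bk]] := jk.
have /has_arrowP[c [cT ck ci]] := ki.
have ab : tgt a = src b by rewrite aj bj.
have E : full_arrows T [set i; j; k] = [set a; b; c].
  by rewrite -ai -bj -bk; apply: full_arrows_triple; rewrite // ai bk ck ci setUC.
split; first by exists a, b, c; rewrite ai bj ck aj bk ci; split.
have [ac bc] : a != c /\ b != c.
  by split; [rewrite eq_sym|]; apply: arrow_neq; rewrite ?ci ?ai ?bk ?ck.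
rewrite (odd_num_crossing E (arrow_neq ab) ac bc).
have [_ sa _] := tile_arrow_sides aT; have [_ _ tc] := tile_arrow_sides cT.
have := src_letter_tail cT; rewrite ci.
have <- : sside a = tside c by apply: (tile_side_unique sa); rewrite ai -ci.
rewrite -ai => cw; have := color_shift aT bT ab cw.
rewrite ai bj bk => /(_ ck ijk) /= <-.
by case: (color a) (color c) => [] [].
Qed.

(** Here c leaves i, so the letter of k has Y-flag [~~ color c]. This negation makes the number of
    crossings odd. *)
Lemma tile_three_pseudocycle i j k :
  has_arrow T i j -> has_arrow T j k -> has_arrow T i k ->
  three_pseudocycle T [set i; j; k].
Proof.
move=> ij jk ik; have [iN jN iNj] := has_arrow_N ij; have [_ kN iNk] := has_arrow_N ik.
have [_ _ jNk] := has_arrow_N jk; have kNi : k != i by rewrite eq_sym.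
have kNj : k != j by rewrite eq_sym.
have sN x : x \in N -> x \in s by rewrite mem_tile_nodes.
have ijk : between s i j k.
  apply/negPn/negP => /(between_neg (sN _ iN) (sN _ jN) jNk) ikj.
  case/negP: (has_arrow_asym ij); apply: (between_Out iN iNj _ jk).
  by rewrite (between_rot tile_seq_uniq (sN _ jN) (sN _ iN) (sN _ kN) iNj kNj kNi).
have /has_arrowP[a [aT ai aj]] := ij; have /has_arrowP[b [bT bj bk]] := jk.
have /has_arrowP[c [cT ci ck]] := ik.
have ab : tgt a = src b by rewrite aj bj.
have E : full_arrows T [set i; j; k] = [set a; b; c].
  by rewrite -ai -bj -bk; apply: full_arrows_triple; rewrite // ai bk ck ci.
split; first by exists a, b, c; rewrite ai bj aj bk ci ck; split.
have ac : a != c by apply/eqP => ac; rewrite -aj ac ck eqxx in kNj.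
have bc : b != c by apply/eqP => bc; rewrite -bj bc ci eqxx in iNj.
rewrite (odd_num_crossing E (arrow_neq ab) ac bc).
have [_ sa _] := tile_arrow_sides aT; have [_ sc _] := tile_arrow_sides cT.
have := tgt_letter_tail cT; rewrite ci.
have <- : sside a = sside c by apply: (tile_side_unique sa); rewrite ai -ci.
rewrite -ai => cw; have := color_shift aT bT ab cw.
rewrite ai bj bk => /(_ ck ijk) /= <-.
by case: (color a) (color c) => [] [].
Qed.

Lemma tile_triple i j k : i \in N -> j \in N -> k \in N ->
  i != j -> j != k -> i != k ->
  three_cycle T [set i; j; k] \/ three_pseudocycle T [set i; j; k].
Proof.
have set3_rot x y z : [set x; y; z] = [set y; z; x] by rewrite -setUA setUC.
have set3_swap x y z : [set x; y; z] = [set y; x; z] by rewrite [[set x; y]]setUC.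
move=> iN jN kN ij jk ik.
case/orP: (has_arrow_total iN jN ij) => aij;
  case/orP: (has_arrow_total jN kN jk) => ajk;
  case/orP: (has_arrow_total iN kN ik) => aik.
- by right; apply: tile_three_pseudocycle.
- by left; apply: tile_three_cycle.
- by right; rewrite set3_swap set3_rot; apply: tile_three_pseudocycle.
- by right; rewrite -set3_rot; apply: tile_three_pseudocycle.
- by right; rewrite set3_swap; apply: tile_three_pseudocycle.
- by right; rewrite set3_rot; apply: tile_three_pseudocycle.
- by left; rewrite set3_swap; apply: tile_three_cycle.
- by right; rewrite set3_swap -set3_rot; apply: tile_three_pseudocycle.
Qed.

End Tiles.

Theorem theorem4p23 (Q : ordered_quiver) (hQ : ST_compatible Q)
    (p : node Q * bool) :
  let N := tile_nodes p in
  let A := tile_arrows p in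
  [/\ locally_transitive_tournament N A,
      forall S : {set node Q}, S \subset N -> #|S| = 3%N ->
        three_cycle A S \/ three_pseudocycle A S
    & exists s : seq (node Q),
        [/\ uniq s, s =i N &
          forall (k : node Q) (f : bool), (k, f) \in tile_sides p ->
            exists n : nat, angle_nodes k f = rot n s]].
Proof.
move=> N A; split; first exact: tile_locally_transitive.
  move=> S /subsetP SN S3.
  have : size (enum S) = 3 by rewrite -cardE.
  case E: (enum S) (enum_uniq (mem S)) => [|i [|j [|k []]]] // U _.
  have memS x : (x \in S) = (x \in [:: i; j; k]) by rewrite -E mem_enum.
  have -> : S = [set i; j; k] by apply/setP => x; rewrite memS !inE orbA.
  move: U; rewrite /= !inE !negb_or -!andbA => /and4P[ij ik jk _].
  by apply: tile_triple => //; apply: SN; rewrite memS !inE eqxx ?orbT.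
exists (map fst (sides p)); split; [exact: tile_seq_uniq | exact: mem_tile_nodes |].
move=> k f /(tile_sides_rot hQ)/rotates_map-/(_ _ fst)[n En].
by apply: rotates_trans (angle_nodes_rot k f); exists n.
Qed.
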